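(* Let $\gamma$ be a (smooth, Riemannian) metric on a 3-dimensional manifold, let $R$ be its Ricci tensor and $\nabla$ its Levi-Civita connection, and put $s = \operatorname{tr} R^2$, $t = \operatorname{tr} R^3$. Then $\gamma$ is locally the spatial metric of an $A$-metric or a $C$-metric if and only if the following conditions hold, at every point: $$\operatorname{tr} R = 0, \qquad 6 t^2 = s^3, \qquad P(\mathrm{d} s) \neq 0, \qquad \text{where } P = 6 R^2 - s\,\gamma,$$ and $$R = \frac{1}{V}\, \nabla \mathrm{d} V, \qquad \text{where } V = \left[P\big(\mathrm{d} s^{-2/3}, \mathrm{d} s^{-2/3}\big)\right]^{1/2}.$$
   Context: All objects are smooth. Considerations are local: ''$\gamma$ is locally the spatial metric of...'' means that every point has an open neighbourhood on which the property holds. Indices are raised and lowered with $\gamma$. $R^2$ and $R^3$ denote the powers of $R$ viewed as an endomorphism, i.e. $(R^2)_{ij} = R_{ik}R^{k}{}_{j}$, etc.; $\operatorname{tr}$ is the trace with respect to $\gamma$. For a symmetric 2-tensor $P$ and functions $f,h$, $P(\mathrm{d}f)$ is the contraction $P_i{}^{j}\partial_j f$, and $P(\mathrm{d}f,\mathrm{d}h) = P^{ij}\partial_i f\,\partial_j h$. $\nabla \mathrm{d} V$ is the Hessian of $V$. Static vacuum solution: a Lorentzian metric $g = -e^{2U(x^k)}\mathrm{d}T^2 + \gamma_{ij}(x^k)\,\mathrm{d}x^i \mathrm{d}x^j$ which is Ricci-flat. Equivalently, the 3-metric $\gamma$ (the spatial metric of $g$) and the function $U$ (the potential) satisfy $$\operatorname{tr}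 R = 0, \qquad R = \nabla\chi + \chi\otimes\chi, \qquad \chi = \mathrm{d}U .$$ The electric part of the Weyl tensor of $g$ relative to the static observer equals $R$, and the magnetic part vanishes. A static vacuum solution $g$ is of Petrov-Bel type $D$ when, at every point, $R$ has exactly one double eigenvalue $\mu \neq 0$ and a simple eigenvalue $-2\mu$; $\mu$ is called the (double) Weyl eigenvalue. Let $e$ be a unit eigenvector of $R$ for the simple eigenvalue. The time-like principal plane of $g$ is the plane spanned by $\partial_T$ and $e$; the space-like principal plane is its orthogonal complement. Type $D$ static vacuum metrics are divided into three classes (Ehlers-Kundt) according to the gradient of the Weyl eigenvalue $\mu$: a $B$-metric is one for which this gradient lies in the space-like principal plane at every point, i.e. $e(\mu)=0$; a (non-$B$) $A$-metric is one for which it lies in the time-like principal plane; a $C$-metric is one for which it lies in neither. Accordingly, ''$g$ is an $A$-metric or a $C$-metric'' means: $g$ is a type $D$ static vacuum solution with $e(\mu)\neq 0$ at every point. *)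

(* Defs.v *)
From mathcomp Require Import all_boot all_order all_algebra.
From mathcomp Require Import all_classical all_reals all_analysis.

Set Implicit Arguments.
Unset Strict Implicit.
Unset Printing Implicit Defensive.

Import Order.TTheory GRing.Theory Num.Theory.
Import numFieldNormedType.Exports.

Local Open Scope classical_set_scope.
Local Open Scope ring_scope.

(* Points, vectors and covectors of R^n are row vectors.  Fields on an open
   subset of R^n are total functions, of which only the values on that subset
   matter. *)

Section coordinate_calculus.
Context {R : realType} {n : nat}.
Implicit Types (f : 'rV[R]_n -> R) (g : 'rV[R]_n -> 'M[R]_n) (x : 'rV[R]_n).

Definition pd (i : 'I_n) f x : R := 'D_(delta_mx 0 i) f x.

Definition grad f x : 'rV[R]_n := \row_i pd i f x.

Fixpoint Ck_on (k : nat) (W : set 'rV[R]_n) f : Prop :=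
  match k with
  | 0 => {in W, continuous f}
  | k'.+1 => {in W, forall x, differentiable f x} /\
             forall i, Ck_on k' W (pd i f)
  end.

Definition smooth_on (W : set 'rV[R]_n) f : Prop := forall k, Ck_on k W f.

Definition inner g x (v w : 'rV[R]_n) : R := (v *m g x *m w^T) 0 0.

Definition christoffel g (k i j : 'I_n) x : R :=
  2^-1 * \sum_l invmx (g x) k l *
    (pd i (fun y => g y j l) x + pd j (fun y => g y i l) x
     - pd l (fun y => g y i j) x).

(* Sign convention: positive on round spheres. *)
Definition ricci g x : 'M[R]_n :=
  \matrix_(i, j)
    (\sum_k (pd k (christoffel g k i j) x - pd j (christoffel g k i k) x)
     + \sum_k \sum_l (christoffel g k k l x * christoffel g l i j x
                      - christoffel g k j l x * christoffel g l i k x)).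

Definition hessian g f x : 'M[R]_n :=
  \matrix_(i, j) (pd i (pd j f) x - \sum_k christoffel g k i j x * pd k f x).

(* R_i^j; acting on row vectors by right multiplication it is the Ricci
   endomorphism of the tangent space, since R_ij is symmetric. *)
Definition ricci_endo g x : 'M[R]_n := ricci g x *m invmx (g x).

End coordinate_calculus.

(* The atlas need not be maximal; [param c] is the inverse of the chart
   [coord c] on its image. *)
Record smooth_manifold (R : realType) (n : nat) := SmoothManifold {
  carrier :> topologicalType;
  mfd_hausdorff : hausdorff_space carrier;
  mfd_second_countable : @second_countable carrier;
  chart : Type;
  dom : chart -> set carrier;
  coord : chart -> carrier -> 'rV[R]_n;
  param : chart -> 'rV[R]_n -> carrier;
  dom_open : forall c, open (dom c);
  dom_cover : forall p, exists c, dom c p;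
  img_open : forall c, open (coord c @` dom c);
  coordK : forall c p, dom c p -> param c (coord c p) = p;
  coord_continuous : forall c, {in dom c, continuous (coord c)};
  param_continuous : forall c, {in coord c @` dom c, continuous (param c)};
  transition_smooth : forall c d i,
    smooth_on (coord c @` (dom c `&` dom d))
      (fun x => coord d (param c x) 0 i)
}.

Definition chart_image (R : realType) (n : nat) (M : smooth_manifold R n)
  (c : chart M) : set 'rV[R]_n := coord c @` dom c.

(* A Riemannian metric, given by its components in the charts.  With the row
   convention, (jacobian tau x) a b is the derivative of the b-th component
   of tau in the a-th direction. *)
Record riemannian_metric (R : realType) (n : nat) (M : smooth_manifold R n) :=
  RiemannianMetric {
  gcomp :> chart M -> 'rV[R]_n -> 'M[R]_n;
  gcomp_smooth : forall c i j,
    smooth_on (chart_image c) (fun x => gcomp c x i j);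
  gcomp_sym : forall c x, chart_image c x -> (gcomp c x)^T = gcomp c x;
  gcomp_posdef : forall c x v, chart_image c x -> v != 0 ->
    0 < inner (gcomp c) x v v;
  gcomp_transition : forall c d x, (coord c @` (dom c `&` dom d)) x ->
    let tau := (fun y => coord d (param c y)) in
    gcomp c x = jacobian tau x *m gcomp d (tau x) *m (jacobian tau x)^T
}.

Section static_vacuum.
Context {R : realType}.

(* - e^{2U} dT^2 + gamma on R x W, the coordinate T being the first one. *)
Definition static_metric n (gamma : 'rV[R]_n -> 'M[R]_n) (U : 'rV[R]_n -> R)
    (y : 'rV[R]_(1 + n)) : 'M[R]_(1 + n) :=
  block_mx (- expR (2 * U (rsubmx y)))%:M 0 0 (gamma (rsubmx y)).

Definition static_vacuum n (W : set 'rV[R]_n) (gamma : 'rV[R]_n -> 'M[R]_n)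
    (U : 'rV[R]_n -> R) : Prop :=
  smooth_on W U /\
  forall y : 'rV[R]_(1 + n), W (rsubmx y) ->
    ricci (static_metric gamma U) y = 0.

Definition double_weyl_eigenvalue (gamma : 'rV[R]_3 -> 'M[R]_3)
    (x : 'rV[R]_3) (mu : R) : Prop :=
  [/\ mu != 0,
      \rank (eigenspace (ricci_endo gamma x) mu) = 2%N &
      \rank (eigenspace (ricci_endo gamma x) (- 2 * mu)) = 1%N].

(* The function mu is determined on W by gamma, and it is smooth there. *)
Definition AC_metric (W : set 'rV[R]_3) (gamma : 'rV[R]_3 -> 'M[R]_3)
    (U : 'rV[R]_3 -> R) : Prop :=
  static_vacuum W gamma U /\
  exists mu : 'rV[R]_3 -> R, forall x, W x ->
    double_weyl_eigenvalue gamma x (mu x) /\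
    forall e : 'rV[R]_3, inner gamma x e e = 1 ->
      e *m ricci_endo gamma x = (- 2 * mu x) *: e -> 'D_e mu x != 0.

(* Every point has, inside each chart around it, an open neighbourhood on
   which the metric is the spatial metric of an A- or C-metric. *)
Definition locally_spatial_AC (M : smooth_manifold R 3)
    (gamma : riemannian_metric M) : Prop :=
  forall (c : chart M) (x : 'rV[R]_3), chart_image c x ->
    exists (W : set 'rV[R]_3) (U : 'rV[R]_3 -> R),
      [/\ open W, W x, W `<=` chart_image c & AC_metric W (gamma c) U].

End static_vacuum.

Section invariants.
Context {R : realType} {n : nat}.
Implicit Types (g : 'rV[R]_n -> 'M[R]_n) (x : 'rV[R]_n).

Definition trR g x : R := \tr (ricci_endo g x).

Definition sinv g x : R := \tr (ricci_endo g x *m ricci_endo g x).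

Definition tinv g x : R :=
  \tr (ricci_endo g x *m ricci_endo g x *m ricci_endo g x).

Definition Ptensor g x : 'M[R]_n :=
  6 *: (ricci g x *m invmx (g x) *m ricci g x) - sinv g x *: g x.

(* P_i^j d_j f *)
Definition Pd g (f : 'rV[R]_n -> R) x : 'cV[R]_n :=
  Ptensor g x *m invmx (g x) *m (grad f x)^T.

(* P^ij d_i f d_j h *)
Definition Pdd g (f h : 'rV[R]_n -> R) x : R :=
  (grad f x *m invmx (g x) *m Ptensor g x *m invmx (g x) *m (grad h x)^T) 0 0.

(* Where the other conditions hold, s > 0 and the radicand is positive. *)
Definition Vpot g x : R :=
  let f := fun y => sinv g y `^ (- (2 / 3)) in Num.sqrt (Pdd g f f x).

End invariants.

(* Main.v *)
(** For a type D metric the Ricci tensor is R = mu (gamma - 3 e (x) e), so that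
    s = 6 mu^2, t = - 6 mu^3 and P = 18 mu^2 e (x) e.  Let U be the potential of
    a static vacuum metric with spatial part gamma, chi = dU, and put
    m = |mu|^(-1/3).  Commuting the derivatives in R = nabla chi + chi (x) chi,
    where in dimension three the curvature is given by R, yields a Codazzi
    equation for R; its contractions say precisely that X = m e satisfies
      nabla_i X_j = phi gamma_ij + chi_i X_j - X_i chi_j,   phi = e(m),
    i.e. that X is a conformal Killing field.  Commuting derivatives once more
    gives d phi = phi dU.  Since V is a constant multiple of |phi|, also
    dV = V dU, which turns the static equation into R = V^-1 nabla dV.
    Conversely, the algebraic conditions force type D (a symmetric operator
    annihilated by (x - mu)^2 (x + 2 mu) is annihilated by (x - mu) (x + 2 mu)),
    the condition P(ds) <> 0 makes V positive and smooth, and U = ln V is the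
    potential. *)

Require Import Defs.
From mathcomp Require Import all_boot all_order all_algebra.
From mathcomp Require Import all_classical all_reals all_analysis.
From mathcomp Require Import ring lra.
Import Order.TTheory GRing.Theory Num.Theory.
Import numFieldNormedType.Exports.
Set Implicit Arguments.
Unset Strict Implicit.
Unset Printing Implicit Defensive.
Local Open Scope classical_set_scope.
Local Open Scope ring_scope.

(** * Partial derivatives and smooth functions *)

(** The unit eigenvector e is determined only up to sign, and no smooth choice of it is given. The
    eigenvalue is therefore recovered as mu = - t / s and the projector e (x) e as a combination of
    gamma and R, both visibly smooth. Where e itself is needed, a column of the projector is
    normalised, on a neighbourhood where the corresponding diagonal entry is positive. For the same
    reason phi is known only up to sign, and V is compared with it through squares. The exponent
    -2/3 comes from s = 6 m^-6: up to a constant s^(-2/3) is m^4, with differential 4 m^3 dm, and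
    the factor mu^2 = m^-6 in P cancels the remaining m^6. What is left of P(ds^(-2/3), ds^(-2/3))
    is a constant times e(m)^2. As P is a multiple of the projector on e, the condition P(ds) <> 0
    says e(s) <> 0, that is, e(mu) <> 0. *)

Lemma near_eq_differentiable (R : numFieldType) (V V' : normedModType R)
    (f g : V -> V') x :
  {near x, f =1 g} -> differentiable f x -> differentiable g x.
Proof.
move=> fg df.
(* The expansion of g is written with the differential of f; uniqueness of the differential then
   identifies the two. *)
have E : g \o shift x = cst (g x) + 'd f x +o_ 0 id.
  apply/eqaddoP => e e0.
  have := diff_locally df => /eqaddoP /(_ e e0).
  have : \forall h \near (0 : V), f (h + x) = g (h + x).
    by have := fg; rewrite (near_shift 0) subr0.
  apply: filterS2 => h fgh.
  by rewrite !fctE /= fgh (nbhs_singleton fg).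
have dgE := diff_unique (diff_continuous df) E.
by apply/diff_locallyP; rewrite dgE; split; [exact: diff_continuous|exact: E].
Qed.

Section smooth_functions.
Context {R : realType} {n : nat}.
Implicit Types (f g : 'rV[R]_n -> R) (x : 'rV[R]_n) (W : set 'rV[R]_n).

Lemma pd_near_eq i f g x : {near x, f =1 g} -> pd i f x = pd i g x.
Proof. exact: near_eq_derive. Qed.

Lemma pd_eq_on W i f g : open W -> (forall x, W x -> f x = g x) ->
  forall x, W x -> pd i f x = pd i g x.
Proof.
move=> oW fg x Wx; apply: pd_near_eq.
by apply: filterS (open_nbhs_nbhs (conj oW Wx)).
Qed.

Lemma pd_cst i (c : R) x : pd i (fun=> c) x = 0.
Proof. exact: derive_cst. Qed.

Lemma pdD i f g x : differentiable f x -> differentiable g x ->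
  pd i (fun y => f y + g y) x = pd i f x + pd i g x.
Proof. by move=> df dg; apply: deriveD; exact: diff_derivable. Qed.

Lemma pdN i f x : differentiable f x -> pd i (fun y => - f y) x = - pd i f x.
Proof. by move=> df; apply: deriveN; exact: diff_derivable. Qed.

Lemma pdB i f g x : differentiable f x -> differentiable g x ->
  pd i (fun y => f y - g y) x = pd i f x - pd i g x.
Proof. by move=> df dg; apply: deriveB; exact: diff_derivable. Qed.

Lemma pdM i f g x : differentiable f x -> differentiable g x ->
  pd i (fun y => f y * g y) x = pd i f x * g x + f x * pd i g x.
Proof.
move=> df dg; rewrite /pd (@deriveM _ _ f g); [|exact: diff_derivable..].
by rewrite addrC mulrC.
Qed.

Lemma pdZ i (c : R) f x : differentiable f x ->
  pd i (fun y => c * f y) x = c * pd i f x.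
Proof. by move=> df; apply: (@deriveZ _ _ _ f); exact: diff_derivable. Qed.

Lemma differentiable_bigsum (I : Type) (r : seq I) (F : I -> 'rV[R]_n -> R) x :
  (forall j, differentiable (F j) x) ->
  differentiable (fun y => \sum_(j <- r) F j y) x.
Proof.
move=> dF; elim: r => [|j r IH].
  by under eq_fun do rewrite big_nil; exact: differentiable_cst.
by under eq_fun do rewrite big_cons; exact: differentiableD.
Qed.

Lemma pd_sum (I : Type) (r : seq I) i (F : I -> 'rV[R]_n -> R) x :
  (forall j, differentiable (F j) x) ->
  pd i (fun y => \sum_(j <- r) F j y) x = \sum_(j <- r) pd i (F j) x.
Proof.
move=> dF; elim: r => [|j r IH].
  by under eq_fun do rewrite big_nil; rewrite pd_cst big_nil.
under eq_fun do rewrite big_cons.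
by rewrite pdD ?IH ?big_cons//; exact: differentiable_bigsum.
Qed.

Lemma pd_comp i (h : R -> R) (dh : R) f x :
  is_derive (f x) 1 h dh -> differentiable f x ->
  differentiable (h \o f) x /\ pd i (h \o f) x = dh * pd i f x.
Proof.
move=> hh df; have dh' : differentiable h (f x).
  by apply/derivable1_diffP; case: hh.
have dhf := differentiable_comp df dh'.
split=> //; rewrite /pd !deriveE// (@diff_comp _ _ _ _ f h)//= deriv1E //.
by rewrite derive1E derive_val; exact: mulrC.
Qed.

Lemma pdV i f x : differentiable f x -> f x != 0 ->
  pd i (fun y => (f y)^-1) x = - (f x)^-1 ^+ 2 * pd i f x.
Proof.
move=> df f0; rewrite /pd (@deriveV _ _ f)//; last exact: diff_derivable.
by rewrite exprVn.
Qed.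

Lemma differentiable_exprn f m x : differentiable f x ->
  differentiable (fun y => f y ^+ m) x.
Proof.
move=> df; elim: m => [|m IH]; first exact: differentiable_cst.
by under eq_fun do rewrite exprS; exact: differentiableM.
Qed.

Lemma pdX i f m x : differentiable f x ->
  pd i (fun y => f y ^+ m.+1) x = m.+1%:R * f x ^+ m * pd i f x.
Proof.
move=> df; elim: m => [|m IH]; first by rewrite expr0 mulr1 mul1r.
under [fun y => _]eq_fun do rewrite exprS.
rewrite pdM//; last exact: differentiable_exprn.
by rewrite IH (exprS _ m) [in RHS]mulrS; ring.
Qed.

Lemma derive_pd f x v : differentiable f x ->
  'D_v f x = \sum_j v 0 j * pd j f x.
Proof.
move=> df; rewrite deriveE// {1}(row_sum_delta v) linear_sum.
by apply: eq_bigr => j _; rewrite linearZ /pd deriveE.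
Qed.

Lemma Ck_onS k W f : Ck_on k.+1 W f -> Ck_on k W f.
Proof.
elim: k f => [|k IH] f [df Hf]; first by move=> x xW; exact:
  differentiable_continuous (df x xW).
by split=> // i; exact: IH.
Qed.

Lemma Ck_on_sub k W W' f : W' `<=` W -> Ck_on k W f -> Ck_on k W' f.
Proof.
move=> sW; have inW x : x \in W' -> x \in W by rewrite !inE; exact: sW.
elim: k f => [|k IH] f; first by move=> cf x xW; exact: cf (inW x xW).
by move=> [df Hf]; split=> [x xW|i]; [exact: df (inW x xW)|exact: IH (Hf i)].
Qed.

Lemma Ck_on_eq k W f g : open W -> (forall x, W x -> f x = g x) ->
  Ck_on k W f -> Ck_on k W g.
Proof.
move=> oW; have nearW x : x \in W -> nbhs x W.
  by rewrite inE => Wx; exact: open_nbhs_nbhs.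
elim: k f g => [|k IH] f g fg /=.
  move=> cf x xW; suff: g @ x --> f x by rewrite (fg x)//; rewrite inE in xW.
  have nfg : {near x, f =1 g} by apply: filterS (nearW _ xW) => y Wy; rewrite fg.
  exact: cvg_trans (near_eq_cvg nfg) (cf x xW).
move=> [df Hf]; split=> [x xW|i].
  apply: near_eq_differentiable (df _ xW).
  by apply: filterS (nearW _ xW) => y Wy; rewrite fg.
by apply: IH (Hf i); exact: pd_eq_on.
Qed.

Lemma Ck_on_cst k W (c : R) : Ck_on k W (fun=> c).
Proof.
elim: k c => [|k IH] c; first by move=> x _; exact: cst_continuous.
split=> [x _|i]; first exact: differentiable_cst.
by rewrite (_ : pd i _ = fun=> 0)//; apply/funext => x; exact: pd_cst.
Qed.

Lemma Ck_onD k W f g : open W ->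
  Ck_on k W f -> Ck_on k W g -> Ck_on k W (fun x => f x + g x).
Proof.
move=> oW; elim: k f g => [|k IH] f g /=.
  by move=> cf cg x xW; exact: continuousD (cf x xW) (cg x xW).
move=> [df Hf] [dg Hg]; split=> [x xW|i].
  by apply: differentiableD; [exact: df|exact: dg].
apply: Ck_on_eq (IH _ _ (Hf i) (Hg i)) => // x Wx.
by rewrite pdD//; [apply: df|apply: dg]; rewrite inE.
Qed.

Lemma Ck_onM k W f g : open W ->
  Ck_on k W f -> Ck_on k W g -> Ck_on k W (fun x => f x * g x).
Proof.
move=> oW; elim: k f g => [|k IH] f g.
  by move=> cf cg x xW; exact: continuousM (cf x xW) (cg x xW).
move=> Cf Cg; have [df Hf] := Cf; have [dg Hg] := Cg; split=> [x xW|i].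
  by apply: differentiableM; [exact: df|exact: dg].
apply: Ck_on_eq (Ck_onD oW (IH _ _ (Hf i) (Ck_onS Cg))
                           (IH _ _ (Ck_onS Cf) (Hg i))) => // x Wx.
by rewrite pdM//; [apply: df|apply: dg]; rewrite inE.
Qed.

Lemma smooth_on_differentiable W f x : smooth_on W f -> W x ->
  differentiable f x.
Proof. by move=> /(_ 1) [df _] Wx; apply: df; rewrite inE. Qed.

Lemma smooth_on_pd W f i : smooth_on W f -> smooth_on W (pd i f).
Proof. by move=> sf k; have [_] := sf k.+1; exact. Qed.

Lemma smooth_on_sub W W' f : W' `<=` W -> smooth_on W f -> smooth_on W' f.
Proof. by move=> sW sf k; exact: Ck_on_sub (sf k). Qed.

Lemma smooth_on_eq W f g : open W -> (forall x, W x -> f x = g x) ->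
  smooth_on W f -> smooth_on W g.
Proof. by move=> oW fg sf k; exact: Ck_on_eq (sf k). Qed.

Lemma smooth_on_cst W (c : R) : smooth_on W (fun=> c).
Proof. by move=> k; exact: Ck_on_cst. Qed.

Lemma smooth_onD W f g : open W ->
  smooth_on W f -> smooth_on W g -> smooth_on W (fun x => f x + g x).
Proof. by move=> oW sf sg k; exact: Ck_onD. Qed.

Lemma smooth_onM W f g : open W ->
  smooth_on W f -> smooth_on W g -> smooth_on W (fun x => f x * g x).
Proof. by move=> oW sf sg k; exact: Ck_onM. Qed.

Lemma smooth_onN W f : open W -> smooth_on W f -> smooth_on W (fun x => - f x).
Proof.
move=> oW sf; apply: smooth_on_eq (smooth_onM oW (smooth_on_cst W (-1)) sf) => //.
by move=> x _; rewrite mulN1r.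
Qed.

Lemma smooth_onB W f g : open W ->
  smooth_on W f -> smooth_on W g -> smooth_on W (fun x => f x - g x).
Proof. by move=> oW sf sg; apply: smooth_onD => //; exact: smooth_onN. Qed.

Lemma smooth_on_sum (I : Type) (r : seq I) (F : I -> 'rV[R]_n -> R) W :
  open W -> (forall j, smooth_on W (F j)) ->
  smooth_on W (fun x => \sum_(j <- r) F j x).
Proof.
move=> oW sF; elim: r => [|j r IH].
  by under eq_fun do rewrite big_nil; exact: smooth_on_cst.
by under eq_fun do rewrite big_cons; exact: smooth_onD.
Qed.

Lemma smooth_on_prod (I : Type) (r : seq I) (F : I -> 'rV[R]_n -> R) W :
  open W -> (forall j, smooth_on W (F j)) ->
  smooth_on W (fun x => \prod_(j <- r) F j x).
Proof.
move=> oW sF; elim: r => [|j r IH].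
  by under eq_fun do rewrite big_nil; exact: smooth_on_cst.
by under eq_fun do rewrite big_cons; exact: smooth_onM.
Qed.

(** By the chain rule the partial derivatives of [h \o f] are [dh \o f] times those of f, so
    regularity is gained one order at a time as soon as [dh \o f] is as regular as [h \o f]. For exp
    and the inverse, [dh] is a polynomial in [h], which makes this immediate. *)
Lemma smooth_on_comp W (h dh : R -> R) f : open W ->
  (forall x, W x -> is_derive (f x) 1 h (dh (f x))) ->
  (forall k, Ck_on k W (h \o f) -> Ck_on k W (dh \o f)) ->
  smooth_on W f -> smooth_on W (h \o f).
Proof.
move=> oW hdh Hk sf.
have dhf i x : W x -> _ := fun Wx => pd_comp i (hdh x Wx)
                                      (smooth_on_differentiable sf Wx).
have dhf' x : W x -> differentiable (h \o f) x.
  move=> Wx; apply: differentiable_comp; first exact: smooth_on_differentiable.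
  by apply/derivable1_diffP; have [] := hdh _ Wx.
elim=> [|k IH].
  by move=> x; rewrite inE => /dhf'; exact: differentiable_continuous.
split=> [x|i]; first by rewrite inE => /dhf'.
apply: Ck_on_eq (Ck_onM oW (Hk k IH) (@smooth_on_pd W f i sf k)) => // x Wx.
by rewrite (dhf i x Wx).2.
Qed.

Lemma smooth_on_expR W f : open W -> smooth_on W f ->
  smooth_on W (fun x => expR (f x)).
Proof. by move=> oW; apply: smooth_on_comp => // x _; exact: is_derive_expR. Qed.

Lemma smooth_onV W f : open W -> (forall x, W x -> f x != 0) ->
  smooth_on W f -> smooth_on W (fun x => (f x)^-1).
Proof.
move=> oW f0; apply: (@smooth_on_comp W GRing.inv (fun y => - (y^-1 * y^-1))) => //.
  move=> x Wx; apply: DeriveDef.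
    by apply: (@derivableV _ _ id); [exact: f0|exact: derivable_id].
  rewrite (@deriveV _ _ id)//; last exact: f0.
  by rewrite derive_id expr2 invfM; exact: mulr1.
move=> k Ck; apply: Ck_on_eq (Ck_onM oW (Ck_on_cst k W (-1)) (Ck_onM oW Ck Ck)) => //.
by move=> x _; rewrite mulN1r.
Qed.

Lemma smooth_on_ln W f : open W -> (forall x, W x -> 0 < f x) ->
  smooth_on W f -> smooth_on W (fun x => ln (f x)).
Proof.
move=> oW f0 sf; apply: (@smooth_on_comp W (@ln R) GRing.inv) => //.
  by move=> x Wx; apply: is_derive1_ln; exact: f0.
move=> k _; apply: smooth_onV => // x Wx; rewrite gt_eqF//; exact: f0.
Qed.

Lemma smooth_on_powR W f a : open W -> (forall x, W x -> 0 < f x) ->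
  smooth_on W f -> smooth_on W (fun x => f x `^ a).
Proof.
move=> oW f0 sf.
apply: smooth_on_eq (smooth_on_expR oW (smooth_onM oW (smooth_on_cst W a)
                                          (smooth_on_ln oW f0 sf))) => // x Wx.
by rewrite /powR gt_eqF//; exact: f0.
Qed.

Lemma smooth_on_sqrt W f : open W -> (forall x, W x -> 0 < f x) ->
  smooth_on W f -> smooth_on W (fun x => Num.sqrt (f x)).
Proof.
move=> oW f0 sf; apply: smooth_on_eq (smooth_on_powR 2^-1 oW f0 sf) => // x Wx.
by rewrite powR12_sqrt// ltW// f0.
Qed.

End smooth_functions.

(** * Symmetry of second derivatives *)

Section mixed_derivatives.
Context {R : realType} {n : nat}.
Implicit Types (f : 'rV[R]_n -> R) (x v w : 'rV[R]_n) (W : set 'rV[R]_n).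

Lemma is_derive_line f x v (t : R) : differentiable f (x + t *: v) ->
  is_derive t 1 (fun s => f (x + s *: v)) ('D_v f (x + t *: v)).
Proof.
move=> df; have E : (fun h : R => h^-1 *: (f (x + (h *: 1 + t) *: v) - f (x + t *: v)))
    = (fun h : R => h^-1 *: (f (h *: v + (x + t *: v)) - f (x + t *: v))).
  apply/funext => h; congr (_ *: (f _ - _)).
  by rewrite scalerDl addrCA [h *: 1]mulr1.
apply: DeriveDef; first by rewrite /derivable /= E; exact: diff_derivable.
by rewrite /derive /= E.
Qed.

(** The mean value theorem is used twice, for the increment [phi] in direction i and then for the
    derivative [psi] in direction j. The left side does not depend on the order of the two
    directions, which is what makes it useful. *)
Lemma second_difference f x i j (h : R) : 0 < h ->
  (forall s t, 0 <= s <= h -> 0 <= t <= h ->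
     let p := x + s *: delta_mx 0 i + t *: delta_mx 0 j in
     differentiable f p /\ differentiable (pd i f) p) ->
  exists s t, [/\ 0 <= s <= h, 0 <= t <= h &
    f (x + h *: delta_mx 0 i + h *: delta_mx 0 j) - f (x + h *: delta_mx 0 i)
      - (f (x + h *: delta_mx 0 j) - f x) =
    h ^+ 2 * pd j (pd i f) (x + s *: delta_mx 0 i + t *: delta_mx 0 j)].
Proof.
set vi := delta_mx 0 i; set vj := delta_mx 0 j; move=> h0 df.
have inh s : s \in `]0, h[ -> 0 <= s <= h.
  by rewrite in_itv/= => /andP[/ltW -> /ltW ->].
have hh : 0 <= h <= h by rewrite lexx ltW.
have h00 : 0 <= (0 : R) <= h by rewrite lexx ltW.
pose phi s := f (x + h *: vj + s *: vi) - f (x + s *: vi).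
have dphi s : 0 <= s <= h ->
    is_derive s 1 phi (pd i f (x + h *: vj + s *: vi) - pd i f (x + s *: vi)).
  move=> sh; apply: is_deriveB; apply: is_derive_line.
    by rewrite addrAC; exact: (df s h sh hh).1.
  by have [] := df s 0 sh h00; rewrite scale0r addr0.
have cphi : {within `[0, h], continuous phi}.
  apply: derivable_within_continuous => s; rewrite in_itv/= => sh.
  by case: (dphi s sh).
have [s sh] := MVT h0 (fun s sh => dphi s (inh s sh)) cphi.
rewrite /phi !scale0r !addr0 subr0 => Es.
pose psi t := pd i f (x + s *: vi + t *: vj).
have dpsi t : 0 <= t <= h ->
    is_derive t 1 psi (pd j (pd i f) (x + s *: vi + t *: vj)).
  by move=> th; apply: is_derive_line; exact: (df s t (inh s sh) th).2.
have cpsi : {within `[0, h], continuous psi}.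
  apply: derivable_within_continuous => t; rewrite in_itv/= => th.
  by case: (dpsi t th).
have [t th] := MVT h0 (fun t th => dpsi t (inh t th)) cpsi.
rewrite /psi scale0r addr0 subr0 => Et.
exists s, t; split; [exact: inh|exact: inh|].
rewrite expr2 mulrC mulrA -Et -[RHS]/(_ * _).
by rewrite [x + _ + s *: _]addrAC in Es; rewrite -[x + h *: vi + _]addrAC -Es; ring.
Qed.

(** The second difference over a small square equals h^2 times either mixed derivative, at two
    possibly different points of the square. The two derivatives thus agree at points near x, and
    continuity at x gives equality up to any e. *)
Lemma pdC W f i j x : open W -> smooth_on W f -> W x ->
  pd i (pd j f) x = pd j (pd i f) x.
Proof.
move=> oW sf Wx; set vi := delta_mx 0 i : 'rV[R]_n; set vj := delta_mx 0 j : 'rV[R]_n.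
apply/eqP; rewrite -subr_eq0 -normr_eq0; apply/eqP; apply/eqP; rewrite eq_le
  normr_ge0 andbT.
apply/ler_addgt0Pl => e e0; rewrite addr0.
have e2 : 0 < e / 2 by rewrite divr_gt0.
have near_cont k l : \forall y \near x, `|pd k (pd l f) x - pd k (pd l f) y| < e / 2.
  have : {for x, continuous (pd k (pd l f))}.
    apply: differentiable_continuous.
    by apply: smooth_on_differentiable Wx; do 2 apply: smooth_on_pd.
  by move=> /cvgrPdist_lt /(_ _ e2).
have : \forall y \near x, [/\ W y, `|pd i (pd j f) x - pd i (pd j f) y| < e / 2
    & `|pd j (pd i f) x - pd j (pd i f) y| < e / 2].
  by have := near_cont j i; have := near_cont i j;
     have := open_nbhs_nbhs (conj oW Wx); apply: filterS3.
move=> /nbhs_ballP[r /= r0 Hr].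
(* With this side length the whole square stays within r / 2 of x; the summand 1 keeps the
   denominator positive. *)
pose h := r / (2 * (`|vi| + `|vj| + 1)).
have d0 : 0 < `|vi| + `|vj| + 1 by rewrite ltr_wpDl.
have h0 : 0 < h by rewrite divr_gt0// mulr_gt0.
have inball s t : 0 <= s <= h -> 0 <= t <= h -> ball x r (x + s *: vi + t *: vj).
  move=> /andP[s0 sh] /andP[t0 th]; rewrite -ball_normE /=.
  rewrite -addrA opprD addNKr normrN; apply: le_lt_trans (ler_normD _ _) _.
  rewrite !normrZ !ger0_norm//.
  apply: (@le_lt_trans _ _ (h * (`|vi| + `|vj| + 1))).
    rewrite mulrDr mulrDr mulr1; apply: ler_wpDr; first exact: ltW.
    by apply: lerD; apply: ler_wpM2r.
  by rewrite /h invfM mulrA mulfVK ?gt_eqF// ltr_pdivrMr// ltr_pMr// ltr1n.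
have df k s t : 0 <= s <= h -> 0 <= t <= h ->
    differentiable f (x + s *: vi + t *: vj) /\
    differentiable (pd k f) (x + s *: vi + t *: vj).
  move=> /inball H /H /Hr[Wy _ _].
  by split; apply: smooth_on_differentiable Wy => //; exact: smooth_on_pd.
have [s [t [sh th E1]]] := second_difference h0 (fun s t sh th => df i s t sh th).
have [t' [s' [th' sh' E2]]] : exists s t, [/\ 0 <= s <= h, 0 <= t <= h &
    f (x + h *: vj + h *: vi) - f (x + h *: vj)
      - (f (x + h *: vi) - f x) =
    h ^+ 2 * pd i (pd j f) (x + s *: vj + t *: vi)].
  by apply: second_difference => // s' t' sh' th'; rewrite addrAC; exact: df.
have Ep : pd j (pd i f) (x + s *: vi + t *: vj) = pd i (pd j f) (x + s' *: vi + t' *: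
  vj).
  have hn0 : h ^+ 2 != 0 by rewrite expf_neq0// gt_eqF.
  rewrite (addrAC x (s' *: vi) (t' *: vj)); apply: (mulfI hn0).
  apply: etrans (esym E1) (etrans _ E2).
  have swap (a b c d : R) : a - b - (c - d) = a - c - (b - d) by ring.
  by rewrite (addrAC x (h *: vi)); exact: swap.
have [_ _ H1] := Hr _ (inball s t sh th).
have [_ H2 _] := Hr _ (inball s' t' sh' th').
rewrite Ep in H1.
rewrite -(subrKA (pd i (pd j f) (x + s' *: vi + t' *: vj))).
apply: le_trans (ler_normD _ _) _; rewrite [leRHS]splitr.
by apply: lerD; [exact: ltW H2|rewrite distrC; exact: ltW H1].
Qed.

End mixed_derivatives.

(** * Functions independent of time *)

Section lifted_functions.
Context {R : realType} {n : nat}.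

Lemma pd_rsubmx i (f : 'rV[R]_n -> R) (y : 'rV[R]_(1 + n)) :
  pd (rshift 1 i) (fun y => f (rsubmx y)) y = pd i f (rsubmx y).
Proof.
suff E : (fun h : R => h^-1 *: (f (rsubmx (h *: delta_mx 0 (rshift 1 i) + y))
                                - f (rsubmx y))) =
    (fun h : R => h^-1 *: (f (h *: delta_mx 0 i + rsubmx y) - f (rsubmx y))).
  by rewrite /pd /derive /= E.
apply/funext => h; congr (_ *: (f _ - _)); apply/rowP => j; rewrite !mxE.
by rewrite eqE/= (inj_eq (@rshift_inj 1 n)).
Qed.

Lemma pd_rsubmx0 (f : 'rV[R]_n -> R) (y : 'rV[R]_(1 + n)) :
  pd (lshift n 0) (fun y => f (rsubmx y)) y = 0.
Proof.
rewrite -[RHS](derive0 f (rsubmx y)).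
suff E : (fun h : R => h^-1 *: (f (rsubmx (h *: delta_mx 0 (lshift n 0) + y))
                                - f (rsubmx y))) =
    (fun h : R => h^-1 *: (f (h *: 0 + rsubmx y) - f (rsubmx y))).
  by rewrite /pd /derive /= E.
apply/funext => h; congr (_ *: (f _ - _)); apply/rowP => j; rewrite !mxE.
by rewrite eq_rlshift andbF !mulr0.
Qed.

End lifted_functions.

(** * Riemannian geometry in a chart *)

Section matrix_fields.
#[local] Opaque pd.
Context {R : realType} {n : nat}.
Implicit Types (x : 'rV[R]_n) (W : set 'rV[R]_n).

Definition smooth_mx W p q (A : 'rV[R]_n -> 'M[R]_(p, q)) :=
  forall i j, smooth_on W (fun x => A x i j).

Definition pdmx p q (k : 'I_n) (A : 'rV[R]_n -> 'M[R]_(p, q)) x : 'M[R]_(p, q) :=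
  \matrix_(i, j) pd k (fun y => A y i j) x.

Lemma smooth_mxM W p q r (A : 'rV[R]_n -> 'M[R]_(p, q)) (B : 'rV[R]_n -> 'M[R]_(q, r)) :
  open W -> smooth_mx W A -> smooth_mx W B -> smooth_mx W (fun x => A x *m B x).
Proof.
move=> oW sA sB i j; under eq_fun do rewrite mxE.
by apply: smooth_on_sum => // k; exact: smooth_onM.
Qed.

Lemma smooth_mxB W p q (A B : 'rV[R]_n -> 'M[R]_(p, q)) :
  open W -> smooth_mx W A -> smooth_mx W B -> smooth_mx W (fun x => A x - B x).
Proof. by move=> oW sA sB i j; under eq_fun do rewrite !mxE; exact: smooth_onB. Qed.

Lemma smooth_mxZ W p q f (A : 'rV[R]_n -> 'M[R]_(p, q)) :
  open W -> smooth_on W f -> smooth_mx W A -> smooth_mx W (fun x => f x *: A x).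
Proof. by move=> oW sf sA i j; under eq_fun do rewrite mxE; exact: smooth_onM. Qed.

Lemma smooth_mx_tr W p q (A : 'rV[R]_n -> 'M[R]_(p, q)) :
  smooth_mx W A -> smooth_mx W (fun x => (A x)^T).
Proof. by move=> sA i j; under eq_fun do rewrite mxE; exact: sA. Qed.

Lemma smooth_mxtrace W p (A : 'rV[R]_n -> 'M[R]_p) :
  open W -> smooth_mx W A -> smooth_on W (fun x => \tr (A x)).
Proof. by move=> oW sA; apply: smooth_on_sum => // j; exact: sA. Qed.

Lemma smooth_grad W f : smooth_on W f -> smooth_mx W (grad f).
Proof.
move=> sf i j; rewrite (_ : (fun x => _) = pd j f); first exact: smooth_on_pd.
by apply/funext => x; rewrite mxE.
Qed.

Lemma smooth_det W p (A : 'rV[R]_n -> 'M[R]_p) :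
  open W -> smooth_mx W A -> smooth_on W (fun x => \det (A x)).
Proof.
move=> oW sA; apply: smooth_on_sum => // s; apply: smooth_onM => //.
  exact: smooth_on_cst.
exact: smooth_on_prod.
Qed.

Lemma smooth_invmx W p (A : 'rV[R]_n -> 'M[R]_p) : open W ->
  (forall x, W x -> A x \in unitmx) -> smooth_mx W A ->
  smooth_mx W (fun x => invmx (A x)).
Proof.
move=> oW uA sA i j.
(* Cramer's rule: the entries of the inverse are cofactors over the determinant. *)
apply: (@smooth_on_eq _ _ _
    (fun x => (\det (A x))^-1 * ((-1) ^+ (j + i) * \det (row' j (col' i (A x)))))) =>
      //.
  by move=> x Wx; rewrite /invmx uA// !mxE.
apply: smooth_onM => //.
  apply: smooth_onV => //; last exact: smooth_det.
  by move=> x Wx; rewrite -unitfE -unitmxE uA.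
apply: smooth_onM => //; first exact: smooth_on_cst.
by apply: smooth_det => // k l; under eq_fun do rewrite !mxE; exact: sA.
Qed.

Lemma pdmxM W p q r k (A : 'rV[R]_n -> 'M[R]_(p, q)) (B : 'rV[R]_n -> 'M[R]_(q, r)) x :
  smooth_mx W A -> smooth_mx W B -> W x ->
  pdmx k (fun x => A x *m B x) x = pdmx k A x *m B x + A x *m pdmx k B x.
Proof.
move=> sA sB Wx; apply/matrixP => i j; rewrite !mxE -big_split/=.
under [fun y => _]eq_fun do rewrite mxE.
have dA a b := smooth_on_differentiable (sA a b) Wx.
have dB a b := smooth_on_differentiable (sB a b) Wx.
rewrite pd_sum => [|l]; last exact: differentiableM.
by apply: eq_bigr => l _; rewrite pdM// !mxE.
Qed.

Lemma pdmxD W p q k (A B : 'rV[R]_n -> 'M[R]_(p, q)) x :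
  smooth_mx W A -> smooth_mx W B -> W x ->
  pdmx k (fun x => A x + B x) x = pdmx k A x + pdmx k B x.
Proof.
move=> sA sB Wx; apply/matrixP => i j; rewrite !mxE.
under [fun y => _]eq_fun do rewrite mxE.
by rewrite pdD//; apply: smooth_on_differentiable Wx; [exact: sA|exact: sB].
Qed.

Lemma pdmxB W p q k (A B : 'rV[R]_n -> 'M[R]_(p, q)) x :
  smooth_mx W A -> smooth_mx W B -> W x ->
  pdmx k (fun x => A x - B x) x = pdmx k A x - pdmx k B x.
Proof.
move=> sA sB Wx; apply/matrixP => i j; rewrite !mxE.
under [fun y => _]eq_fun do rewrite !mxE.
by rewrite pdB//; apply: smooth_on_differentiable Wx; [exact: sA|exact: sB].
Qed.

Lemma pdmx_tr p q k (A : 'rV[R]_n -> 'M[R]_(p, q)) x :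
  pdmx k (fun x => (A x)^T) x = (pdmx k A x)^T.
Proof.
by apply/matrixP => i j; rewrite !mxE; under [fun y => _]eq_fun do rewrite mxE.
Qed.

Lemma pdmx_eq_on W p q k (A B : 'rV[R]_n -> 'M[R]_(p, q)) : open W ->
  (forall x, W x -> A x = B x) -> forall x, W x -> pdmx k A x = pdmx k B x.
Proof.
move=> oW AB x Wx; apply/matrixP => i j; rewrite !mxE.
by apply: (pd_eq_on _ oW) => // y Wy; rewrite AB.
Qed.

Lemma pdmxC W p q i j (A : 'rV[R]_n -> 'M[R]_(p, q)) x :
  open W -> smooth_mx W A -> W x ->
  pdmx i (pdmx j A) x = pdmx j (pdmx i A) x.
Proof.
move=> oW sA Wx; apply/matrixP => a b; rewrite [LHS]mxE [RHS]mxE.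
have E k : (fun y => pdmx k A y a b) = pd k (fun y => A y a b).
  by apply/funext => y; rewrite mxE.
by rewrite (E j) (E i); exact: (pdC i j oW (sA a b) Wx).
Qed.

Lemma smooth_pdmx W p q k (A : 'rV[R]_n -> 'M[R]_(p, q)) :
  smooth_mx W A -> smooth_mx W (pdmx k A).
Proof.
move=> sA i j; rewrite (_ : (fun x => _) = pd k (fun y => A y i j)).
  exact: smooth_on_pd.
by apply/funext => x; rewrite mxE.
Qed.

End matrix_fields.

(* The antisymmetry of the curvature in its last two indices: the hypothesis
   says that the second derivatives of g commute. *)
Lemma commutator_antisym (R : realFieldType) n (A B P Q g : 'M[R]_n) : g^T = g ->
  P *m g + A *m (B *m g + (B *m g)^T) + (P *m g + A *m (B *m g + (B *m g)^T))^T =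
  Q *m g + B *m (A *m g + (A *m g)^T) + (Q *m g + B *m (A *m g + (A *m g)^T))^T ->
  (P - Q + A *m B - B *m A) *m g + ((P - Q + A *m B - B *m A) *m g)^T = 0.
Proof.
move=> gT; rewrite !mulmxDr !mulmxDl !mulNmx !mulmxA.
have -> : B *m (A *m g)^T = (A *m (B *m g)^T)^T.
  by rewrite !trmx_mul !trmxK gT mulmxA.
move: (P *m g) (Q *m g) (A *m B *m g) (B *m A *m g) (A *m (B *m g)^T).
move=> a b c d u /matrixP E; apply/matrixP => i j.
have := E i j; rewrite !mxE.
move: (a i j) (a j i) (b i j) (b j i) (c i j) (c j i) (d i j) (d j i) (u i j) (u j i).
by move=> *; lra.
Qed.

Fact cov_key : unit. Proof. exact: tt. Qed.

Section riemannian_geometry.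
#[local] Opaque pd.
Context {R : realType} {n : nat}.

Definition metric_on (W : set 'rV[R]_n) (g : 'rV[R]_n -> 'M[R]_n) :=
  [/\ open W, smooth_mx W g, forall x, W x -> (g x)^T = g x &
      forall x v, W x -> v != 0 -> 0 < inner g x v v].

Variables (W : set 'rV[R]_n) (g : 'rV[R]_n -> 'M[R]_n).
Hypothesis gW : metric_on W g.
Implicit Types (x v : 'rV[R]_n).
Local Notation G := (christoffel g).

Let oW : open W. Proof. by case: gW. Qed.
Let sg : smooth_mx W g. Proof. by case: gW. Qed.
Let gT x : W x -> (g x)^T = g x. Proof. by case: gW => _ _ + _; apply. Qed.
Let gC x i j : W x -> g x i j = g x j i.
Proof. by move=> /gT {1}<-; rewrite mxE. Qed.

Lemma metric_unit x : W x -> g x \in unitmx.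
Proof.
move=> Wx; rewrite -row_free_unit -kermx_eq0; apply/rowV0P => v /sub_kermxP vg0.
apply/eqP; apply: contraT => v0; have [_ _ _ /(_ x v Wx v0)] := gW.
by rewrite /inner vg0 mul0mx mxE ltxx.
Qed.

Lemma metric_inv_tr x : W x -> (invmx (g x))^T = invmx (g x).
Proof. by move=> Wx; rewrite trmx_inv gT. Qed.

Lemma metric_inv_pos x v : W x -> v != 0 -> 0 < (v *m invmx (g x) *m v^T) 0 0.
Proof.
move=> Wx v0; have [_ _ _ /(_ x (v *m invmx (g x)) Wx)] := gW.
rewrite /inner mulmxKV ?metric_unit// trmx_mul metric_inv_tr// mulmxA; apply.
apply: contra v0 => /eqP v0; apply/eqP.
by rewrite -(mulmxKV (metric_unit Wx) v) v0 mul0mx.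
Qed.

Lemma smooth_metric_inv : smooth_mx W (fun x => invmx (g x)).
Proof. by apply: smooth_invmx => // x; exact: metric_unit. Qed.

Lemma smooth_christoffel k i j : smooth_on W (G k i j).
Proof.
apply: smooth_onM => //; first exact: smooth_on_cst.
apply: smooth_on_sum => // l; apply: smooth_onM => //.
  exact: smooth_metric_inv.
apply: smooth_onB => //; first apply: smooth_onD => //; exact: smooth_on_pd.
Qed.

Lemma christoffelC k i j x : W x -> G k i j x = G k j i x.
Proof.
move=> Wx; congr (_ * _); apply: eq_bigr => l _.
have -> : pd l (fun y => g y i j) x = pd l (fun y => g y j i) x.
  by apply: (pd_eq_on _ oW) Wx => y; exact: gC.
by congr (_ * (_ - _)); exact: addrC.
Qed.

(* Row p, column l: the transpose of the usual connection matrix, so that the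
   covariant derivative of a column of covectors v is [pdmx k v - conn k *m v]. *)
Definition conn k x : 'M[R]_n := \matrix_(p, l) G l k p x.

Lemma smooth_conn k : smooth_mx W (conn k).
Proof.
move=> p l; rewrite (_ : (fun x => _) = G l k p); first exact: smooth_christoffel.
by apply/funext => x; rewrite mxE.
Qed.

Lemma christoffel_lower i j p x : W x ->
  \sum_k G k i j x * g x k p =
  2^-1 * (pd i (fun y => g y j p) x + pd j (fun y => g y i p) x
          - pd p (fun y => g y i j) x).
Proof.
move=> Wx; rewrite /christoffel.
set a := fun l => pd i (fun y => g y j l) x + pd j (fun y => g y i l) x
          - pd l (fun y => g y i j) x.
rewrite -[X in _ = _ * X]/(a p).
under eq_bigr => k _ do rewrite -mulrA mulr_suml.
rewrite -mulr_sumr exchange_big/=; congr (_ * _).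
under eq_bigr => l _ do under eq_bigr => k _ do rewrite mulrAC.
under eq_bigr => l _ do rewrite -mulr_suml.
have Hd l : \sum_k invmx (g x) k l * g x k p = (l == p)%:R.
  have := mulVmx (metric_unit Wx) => /matrixP/(_ l p); rewrite !mxE => <-.
  by apply: eq_bigr => k _; congr (_ * _); rewrite -{1}(metric_inv_tr Wx) mxE.
under eq_bigr => l _ do rewrite Hd.
rewrite (bigD1 p)//= eqxx mul1r big1 ?addr0// => l /negPf->; exact: mul0r.
Qed.

(** This is the compatibility of the Levi-Civita connection with g, in terms of connection
    matrices. *)
Lemma pdmx_metric k x : W x -> pdmx k g x = conn k x *m g x + (conn k x *m g x)^T.
Proof.
move=> Wx; apply/matrixP => i j; rewrite !mxE.
under eq_bigr do rewrite mxE; under [X in _ = _ + X]eq_bigr do rewrite mxE.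
rewrite !christoffel_lower//.
have -> : pd k (fun y => g y j i) x = pd k (fun y => g y i j) x.
  by apply: (pd_eq_on _ oW) Wx => y; exact: gC.
by move: (pd k _ x) (pd i _ x) (pd j _ x) => a b c; field.
Qed.

(** The entry at p, l is the component R^l_pki; the products stand in the reversed order because
    [conn] is transposed. *)
Definition riem k i x : 'M[R]_n :=
  pdmx k (conn i) x - pdmx i (conn k) x + conn i x *m conn k x - conn k x *m conn i x.

#[local] Opaque christoffel.

(** Second derivatives of g itself commute, and by metric compatibility each of them is an
    expression in [conn] and its derivatives. *)
Lemma riem_antisym k i x : W x -> riem k i x *m g x + (riem k i x *m g x)^T = 0.
Proof.
move=> Wx; have := pdmxC k i oW sg Wx.
have E a b : pdmx a (pdmx b g) x =
    pdmx a (conn b) x *m g x + conn b x *m (conn a x *m g x + (conn a x *m g x)^T) +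
    (pdmx a (conn b) x *m g x + conn b x *m (conn a x *m g x + (conn a x *m g x)^T))^T.
  rewrite (pdmx_eq_on a oW (pdmx_metric b) Wx).
  have sc := smooth_mxM oW (smooth_conn b) sg.
  rewrite (pdmxD _ sc (smooth_mx_tr sc) Wx) pdmx_tr (pdmxM _ (smooth_conn b) sg Wx).
  by rewrite pdmx_metric.
rewrite !E; exact: commutator_antisym (gT Wx).
Qed.

(** An endomorphism that is antisymmetric once an index is lowered is conjugate to minus its
    transpose. The vanishing trace is what makes the Ricci tensor symmetric. *)
Lemma tr_riem k i x : W x -> \tr (riem k i x) = 0.
Proof.
move=> Wx; have /eqP := riem_antisym k i Wx; rewrite addr_eq0 => /eqP E.
have : riem k i x = - (g x *m (riem k i x)^T *m invmx (g x)).
  rewrite -[LHS](mulmxK (metric_unit Wx)) E -mulNmx trmx_mul gT//.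
move=> /(congr1 mxtrace); rewrite linearN/= -mulmxA mxtrace_mulC -mulmxA.
rewrite mulVmx ?metric_unit// mulmx1 mxtrace_tr => H; lra.
Qed.

Lemma riemE k i p l x : riem k i x p l =
  pd k (G l i p) x - pd i (G l k p) x +
  \sum_m (G l k m x * G m i p x - G l i m x * G m k p x).
Proof.
have Ec a b c : (fun y => conn a y b c) = G c a b by apply/funext => y; rewrite mxE.
have eD (A B : 'M[R]_n) : (A + B) p l = A p l + B p l by rewrite mxE.
have eN (A : 'M[R]_n) : (- A) p l = - A p l by rewrite mxE.
have eP a A : pdmx a A x p l = pd a (fun y => A y p l) x by rewrite mxE.
have eM a b : (conn a x *m conn b x) p l = \sum_m G l b m x * G m a p x.
  by rewrite mxE; apply: eq_bigr => m _; rewrite !mxE mulrC.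
by rewrite /riem !(eD, eN, eP, eM, Ec) -addrA sumrB.
Qed.

Lemma connE k x p l : conn k x p l = G l k p x.
Proof. by rewrite mxE. Qed.

#[local] Opaque conn.

Lemma riemC k i x : riem k i x = - riem i k x.
Proof.
rewrite /riem; move: (pdmx k _ _) (pdmx i _ _) (conn i x *m _) (_ *m conn i x).
by move=> a b c d; apply/matrixP => s t; rewrite !mxE; ring.
Qed.

Lemma riem_connE k i x : riem k i x = pdmx k (conn i) x - pdmx i (conn k) x
  + conn i x *m conn k x - conn k x *m conn i x.
Proof. by []. Qed.

#[local] Opaque riem.

Lemma riem_bianchi k i p l x : W x ->
  riem k i x p l + riem i p x k l + riem p k x i l = 0.
Proof.
move=> Wx.
apply: etrans (congr2 +%R (congr2 +%R (riemE k i p l x) (riemE i p k l x))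
                          (riemE p k i l x)) _.
have pdG a b c d : pd a (G b c d) x = pd a (G b d c) x.
  by apply: (pd_eq_on _ oW) Wx => y; exact: christoffelC.
rewrite (pdG i l p k) (pdG p l i k) (pdG k l i p).
(* After exchanging lower indices only three derivative terms u, v, w remain, and they cancel
   cyclically. *)
have cancel (u v w a b c : R) : a + b + c = 0 ->
    u - v + a + (v - w + b) + (w - u + c) = 0 by move=> H; rewrite -[RHS]H; ring.
apply: cancel; rewrite -!big_split/=; apply: big1 => m _.
rewrite (christoffelC m p k Wx) (christoffelC m p i Wx) (christoffelC m i k Wx).
move: (G l k m x) (G l i m x) (G l p m x) (G m i p x) (G m k p x) (G m k i x) => *.
ring.
Qed.

Lemma ricciE i j x : W x -> ricci g x i j = \sum_k riem k j x i k.
Proof.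
move=> Wx; rewrite mxE -big_split/=; apply: eq_bigr => k _; rewrite riemE.
have pdG a b c d : pd a (G b c d) x = pd a (G b d c) x.
  by apply: (pd_eq_on _ oW) Wx => y; exact: christoffelC.
rewrite (pdG k k j i) (pdG j k k i); congr (_ + _); apply: eq_bigr => m _.
by rewrite (christoffelC m j i Wx) (christoffelC m k i Wx).
Qed.

(** Contraction of the Bianchi identity: the middle term is the trace of a curvature endomorphism,
    and the outer two are the two orders of the Ricci indices. *)
Lemma ricci_tr x : W x -> (ricci g x)^T = ricci g x.
Proof.
move=> Wx; apply/matrixP => i j; rewrite mxE !ricciE//.
have : \sum_k (riem k i x j k + riem i j x k k + riem j k x i k) = 0.
  by apply: big1 => k _; exact: riem_bianchi.
rewrite !big_split/= -[X in _ + X + _]/(\tr (riem i j x)) tr_riem// addr0.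
move/eqP; rewrite addr_eq0 => /eqP ->; rewrite -sumrN.
by apply: eq_bigr => k _; rewrite (riemC k j) [in RHS]mxE.
Qed.

Lemma smooth_ricci : smooth_mx W (ricci g).
Proof.
move=> i j; have sG := smooth_christoffel.
under eq_fun do rewrite mxE.
apply: smooth_onD => //; apply: smooth_on_sum => // k.
  by apply: smooth_onB => //; exact: smooth_on_pd.
by apply: smooth_on_sum => // l; apply: smooth_onB => //; exact: smooth_onM.
Qed.

(* Locked, lest entrywise rewriting unfold it. *)
Definition cov1 k (v : 'rV[R]_n -> 'cV[R]_n) x : 'cV[R]_n :=
  locked_with cov_key (pdmx k v x - conn k x *m v x).

Lemma cov1E k (v : 'rV[R]_n -> 'cV[R]_n) x : cov1 k v x = pdmx k v x - conn k x *m v x.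
Proof. exact: locked_withE. Qed.

Definition cov2 k (T : 'rV[R]_n -> 'M[R]_n) x : 'M[R]_n :=
  locked_with cov_key (pdmx k T x - conn k x *m T x - T x *m (conn k x)^T).

Lemma cov2E k (T : 'rV[R]_n -> 'M[R]_n) x : cov2 k T x = pdmx k T x - conn k x *m T x
  - T x *m (conn k x)^T.
Proof. exact: locked_withE. Qed.

Lemma cov1_eq_on k (v w : 'rV[R]_n -> 'cV[R]_n) x :
  (forall y, W y -> v y = w y) -> W x -> cov1 k v x = cov1 k w x.
Proof. by move=> vw Wx; rewrite !cov1E (pdmx_eq_on k oW vw Wx) vw. Qed.

Lemma cov1_commutator k i (v : 'rV[R]_n -> 'cV[R]_n) x : smooth_mx W v -> W x ->
  cov1 k (cov1 i v) x - cov1 i (cov1 k v) x = - (riem k i x *m v x).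
Proof.
move=> sv Wx; have sGv a : smooth_mx W (fun y => conn a y *m v y).
  by apply: smooth_mxM => //; exact: smooth_conn.
have E a b : cov1 a (cov1 b v) x = pdmx a (pdmx b v) x - pdmx a (conn b) x *m v x
    - conn b x *m pdmx a v x - conn a x *m pdmx b v x + conn a x *m conn b x *m v x.
  have -> : cov1 a (cov1 b v) x = cov1 a (fun y => pdmx b v y - conn b y *m v y) x.
    by apply: cov1_eq_on Wx => y _; rewrite cov1E.
  rewrite !cov1E (pdmxB _ (smooth_pdmx b sv) (sGv b) Wx).
  rewrite (pdmxM _ (smooth_conn b) sv Wx) mulmxBr opprD opprB !addrA mulmxA.
  by rewrite addrAC.
have alg (D a b c d a' d' : 'cV[R]_n) : D - a - b - c + d - (D - a' - c - b + d')
    = - (a - a' + d' - d) by apply/matrixP => s t; rewrite !mxE; ring.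
by rewrite !E (pdmxC i k oW sv Wx) riem_connE !mulmxDl !mulNmx; exact: alg.
Qed.

Lemma cov2_eq_on k (S T : 'rV[R]_n -> 'M[R]_n) x :
  (forall y, W y -> S y = T y) -> W x -> cov2 k S x = cov2 k T x.
Proof. by move=> ST Wx; rewrite !cov2E (pdmx_eq_on k oW ST Wx) ST. Qed.

Lemma cov2_row k (T : 'rV[R]_n -> 'M[R]_n) x i j :
  cov2 k T x i j = cov1 k (fun y => (row i (T y))^T) x j 0 - (conn k x *m T x) i j.
Proof.
rewrite cov2E cov1E !mxE addrAC; congr (_ - _ - _).
  by congr (pd k _ x); apply/funext => y; rewrite !mxE.
by apply: eq_bigr => l _; rewrite !mxE mulrC.
Qed.

(** [B] holds the covariant derivative of v. In [cov1_commutator] the index of the inner derivative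
    is a mere label; differentiating [B] as a tensor adds a Christoffel term on that index, which is
    symmetric in k and i and drops out of the difference. *)
Lemma ricci_identity (v : 'rV[R]_n -> 'cV[R]_n) (B : 'rV[R]_n -> 'M[R]_n) k i j x :
  smooth_mx W v -> (forall i x, W x -> cov1 i v x = (row i (B x))^T) -> W x ->
  cov2 k B x i j - cov2 i B x k j = - (riem k i x *m v x) j 0.
Proof.
move=> sv vB Wx.
apply: etrans (congr2 (fun a b => a - b) (cov2_row k B x i j) (cov2_row i B x k j)) _.
have -> : (conn k x *m B x) i j = (conn i x *m B x) k j.
  rewrite [LHS]mxE [RHS]mxE; apply: eq_bigr => l _.
  by rewrite !connE (christoffelC l k i Wx).
have E a b : cov1 a (fun y => (row b (B y))^T) x = cov1 a (cov1 b v) x.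
  by apply: cov1_eq_on Wx => y Wy; rewrite vB.
have cancel (a b c : R) : a - b - (c - b) = a - c by ring.
rewrite E E cancel; have /matrixP/(_ j 0) := cov1_commutator k i sv Wx.
by rewrite [in LHS]mxE [(- cov1 i _ x) _ _]mxE [in RHS]mxE.
Qed.

Lemma cov2_metric k x : W x -> cov2 k g x = 0.
Proof.
move=> Wx; rewrite !cov2E pdmx_metric// trmx_mul gT//.
by rewrite [_ *m g x + _]addrC addrK subrr.
Qed.

Lemma cov2D k (S T : 'rV[R]_n -> 'M[R]_n) x : smooth_mx W S -> smooth_mx W T ->
  W x -> cov2 k (fun y => S y + T y) x = cov2 k S x + cov2 k T x.
Proof.
move=> sS sT Wx; rewrite !cov2E (pdmxD _ sS sT Wx) mulmxDr mulmxDl.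
by rewrite !opprD !addrA; apply/matrixP => i j; rewrite !mxE; ring.
Qed.

Lemma cov2B k (S T : 'rV[R]_n -> 'M[R]_n) x : smooth_mx W S -> smooth_mx W T ->
  W x -> cov2 k (fun y => S y - T y) x = cov2 k S x - cov2 k T x.
Proof.
move=> sS sT Wx; rewrite !cov2E (pdmxB _ sS sT Wx) mulmxBr mulmxBl.
by rewrite !opprD !addrA; apply/matrixP => i j; rewrite !mxE; ring.
Qed.

Lemma pdmxZ p q k f (A : 'rV[R]_n -> 'M[R]_(p, q)) x :
  smooth_on W f -> smooth_mx W A -> W x ->
  pdmx k (fun y => f y *: A y) x = pd k f x *: A x + f x *: pdmx k A x.
Proof.
move=> sf sA Wx; apply/matrixP => i j; rewrite !mxE.
under [fun y => _]eq_fun do rewrite mxE.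
by rewrite pdM//; apply: smooth_on_differentiable Wx => //; exact: sA.
Qed.

Lemma cov2Z k f (T : 'rV[R]_n -> 'M[R]_n) x : smooth_on W f -> smooth_mx W T ->
  W x -> cov2 k (fun y => f y *: T y) x = pd k f x *: T x + f x *: cov2 k T x.
Proof.
move=> sf sT Wx; rewrite !cov2E pdmxZ// -scalemxAr -scalemxAl.
by rewrite !scalerBr !addrA.
Qed.

Lemma cov2_outer k (v w : 'rV[R]_n -> 'cV[R]_n) x : smooth_mx W v -> smooth_mx W w ->
  W x -> cov2 k (fun y => v y *m (w y)^T) x =
         cov1 k v x *m (w x)^T + v x *m (cov1 k w x)^T.
Proof.
move=> sv sw Wx; rewrite !cov2E (pdmxM _ sv (smooth_mx_tr sw) Wx) pdmx_tr !cov1E.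
rewrite mulmxBl linearB/= mulmxBr trmx_mul !mulmxA !addrA.
by congr (_ - _); rewrite addrAC.
Qed.

(** Obtained by differentiating g^-1 g = 1. *)
Lemma pdmx_metric_inv k x : W x ->
  pdmx k (fun y => invmx (g y)) x =
  - (invmx (g x) *m conn k x + (invmx (g x) *m conn k x)^T).
Proof.
move=> Wx; have u := metric_unit Wx.
have : pdmx k (fun y => invmx (g y) *m g y) x = 0.
  rewrite (@pdmx_eq_on _ _ W _ _ _ _ (fun=> 1%:M))//.
    by apply/matrixP => i j; rewrite !mxE pd_cst.
  by move=> y Wy; rewrite mulVmx// metric_unit.
rewrite (pdmxM _ smooth_metric_inv sg Wx) pdmx_metric// => /eqP.
rewrite addr_eq0 => /eqP E; rewrite -[LHS](mulmxK u) E mulNmx; congr (- _).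
by rewrite mulmxDr mulmxDl mulmxA (mulmxK u) !trmx_mul gT// metric_inv_tr// mulKmx.
Qed.

Lemma pd_inner_inv k (v w : 'rV[R]_n -> 'cV[R]_n) x :
  smooth_mx W v -> smooth_mx W w -> W x ->
  pd k (fun y => ((v y)^T *m invmx (g y) *m w y) 0 0) x =
  ((cov1 k v x)^T *m invmx (g x) *m w x + (v x)^T *m invmx (g x) *m cov1 k w x) 0 0.
Proof.
move=> sv sw Wx; have svT := smooth_mx_tr sv; have sgi := smooth_metric_inv.
have svg := smooth_mxM oW svT sgi.
transitivity (pdmx k (fun y => (v y)^T *m invmx (g y) *m w y) x 0 0).
  by rewrite mxE.
rewrite (pdmxM _ svg sw Wx) (pdmxM _ svT sgi Wx) pdmx_tr pdmx_metric_inv//.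
congr ((_ : 'M[R]_1) 0 0); rewrite !cov1E linearB/= !trmx_mul metric_inv_tr//.
rewrite !(mulmxDl, mulmxDr, mulmxBl, mulmxBr, mulNmx, mulmxN) !mulmxA.
by apply/matrixP => i j; rewrite ![in LHS]mxE ![in RHS]mxE; ring.
Qed.

End riemannian_geometry.

(** * Three-dimensional tensor algebra *)

Section three_dimensional_algebra.
Variable F : realFieldType.

Let o0 : 'I_3 := Ordinal (isT : (0 < 3)%N).
Let o1 : 'I_3 := Ordinal (isT : (1 < 3)%N).
Let o2 : 'I_3 := Ordinal (isT : (2 < 3)%N).

Lemma ord3_ind (P : 'I_3 -> Prop) : P o0 -> P o1 -> P o2 -> forall i, P i.
Proof.
move=> P0 P1 P2 [[|[|[|//]]] ilt].
- by rewrite (_ : Ordinal _ = o0)//; exact: val_inj.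
- by rewrite (_ : Ordinal _ = o1)//; exact: val_inj.
- by rewrite (_ : Ordinal _ = o2)//; exact: val_inj.
Qed.

Lemma sum3E (f : 'I_3 -> F) : \sum_i f i = f o0 + f o1 + f o2.
Proof.
rewrite !big_ord_recl big_ord0 addr0 addrA.
by congr (f _ + f _ + f _); exact: val_inj.
Qed.

(* In dimension 3 a tensor with the pair antisymmetries of the curvature is
   determined by its contraction, without using the pair symmetry. *)
Lemma curvature3_contraction (t : 'I_3 -> 'I_3 -> 'I_3 -> 'I_3 -> F)
    (r : 'I_3 -> 'I_3 -> F) :
  (forall k i j l, t k i j l = - t i k j l) ->
  (forall k i j l, t k i j l = - t k i l j) ->
  (forall i l, \sum_k t k i k l = r i l) -> \sum_i r i i = 0 ->
  forall k i j l, t k i j l = (k == j)%:R * r i l + (i == l)%:R * r k j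
    - (k == l)%:R * r i j - (i == j)%:R * r k l.
Proof.
move=> a1 a2 rE; have {rE}-> : r = (fun i l => \sum_k t k i k l).
  by apply/funext => i; apply/funext => l; rewrite rE.
have z1 k j l : t k k j l = 0 by have := a1 k k j l; move: (t _ _ _ _) => *; lra.
have z2 k i j : t k i j j = 0 by have := a2 k i j j; move: (t _ _ _ _) => *; lra.
have s := sum3E.
have a10 := a1 o1 o0; have a20 := a1 o2 o0; have a21 := a1 o2 o1.
have b10 k i := a2 k i o1 o0; have b20 k i := a2 k i o2 o0; have b21 k i := a2 k i o2
  o1.
rewrite !s !(z1, z2) !(a10, a20, a21) !(b10, b20, b21).
move=> tr0 k i j l.
(* Up to sign only nine components of t remain, one for each two pairs of distinct indices; all 81
   identities are linear in them. *)
elim/ord3_ind: k; elim/ord3_ind: i; elim/ord3_ind: j; elim/ord3_ind: l;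
  rewrite !s ?(z1, z2) ?(a10, a20, a21) ?(b10, b20, b21) ?eqxx /=; lra.
Qed.

Section conformal_killing.
Variables (g gi : 'I_3 -> 'I_3 -> F) (X chi n : 'I_3 -> F) (b : 'I_3 -> 'I_3 -> F) (M
  : F).
Hypothesis giC : forall i j, gi i j = gi j i.
Hypothesis gC : forall i j, g i j = g j i.
Hypothesis gig : forall i j, \sum_k gi i k * g k j = (i == j)%:R.
Let Xu i := \sum_j gi i j * X j.
Let dot v := \sum_i Xu i * v i.
Hypothesis M0 : M != 0.
Hypothesis dotX : dot X = M.

Let dot_g j : dot (fun i => g i j) = X j.
Proof.
rewrite /dot /Xu; under eq_bigr do rewrite mulr_suml; rewrite exchange_big/=.
under eq_bigr => k _ do (under eq_bigr => i _ do rewrite giC mulrAC; rewrite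
  -mulr_suml gig).
by rewrite (bigD1 j)//= eqxx mul1r big1 ?addr0// => i /negPf->; exact: mul0r.
Qed.

Let contr f := \sum_i \sum_j gi i j * f i j.

Let eq_dot f h : (forall i, f i = h i) -> dot f = dot h.
Proof. by move=> fh; apply: eq_bigr => i _; rewrite fh. Qed.

Let eq_contr f h : (forall i j, f i j = h i j) -> contr f = contr h.
Proof. by move=> fh; apply: eq_bigr => i _; apply: eq_bigr => j _; rewrite fh. Qed.

Let contr_g : contr g = 3.
Proof.
rewrite /contr; under eq_bigr => i _ do under eq_bigr => j _ do rewrite gC.
by under eq_bigr => i _ do rewrite gig eqxx /=; rewrite sum3E; ring.
Qed.

Let contr_vg v k : contr (fun i j => v i * g k j) = v k.
Proof.
rewrite /contr; under eq_bigr => i _ do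
  (under eq_bigr => j _ do rewrite mulrCA gC; rewrite -mulr_sumr gig).
by rewrite (bigD1 k)//= eqxx mulr1 big1 ?addr0// => i /negPf->; exact: mulr0.
Qed.

Let contr_vX v : contr (fun i j => v i * X j) = dot v.
Proof.
rewrite /contr /dot; apply: eq_bigr => i _; rewrite mulr_suml.
by apply: eq_bigr => j _; ring.
Qed.

Let contr_Xv v : contr (fun i j => X i * v j) = dot v.
Proof.
rewrite -contr_vX /contr exchange_big/=; apply: eq_bigr => i _.
by apply: eq_bigr => j _; rewrite giC; ring.
Qed.

(* Here n = d ln m, M = m^2 and [b k j] is the covariant derivative of X; only
   the contractions of the Codazzi equation with g^ij and with X^i are used. *)
Lemma conformal_killing_algebra :
  (forall k, dot (b k) = M * n k) ->
  (forall k i j, M * (n k * g i j - n i * g k j)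
     - 5 * (n k * X i - n i * X k) * X j + (b k i - b i k) * X j
     + X i * b k j - X k * b i j =
     M * (chi k * g i j - chi i * g k j) + 2 * (chi i * X k - chi k * X i) * X j
     + dot chi * (g k j * X i - g i j * X k)) ->
  forall k j, b k j = dot n * g k j + chi k * X j - X k * chi j.
Proof.
move=> bX codazzi; set a := dot n; set c := dot chi.
pose D := contr b; pose bX' j := dot (fun i => b i j).
(* Trace of the Codazzi equation over i and j. It gives X^i b_ik in terms of the divergence [D]. *)
have step1 k : bX' k = - M * n k + (5 * a - D) * X k.
  have := eq_contr (codazzi k).
  set lhs := contr _; set rhs := contr _.
  have -> : lhs = M * (n k * contr g - contr (fun i j => n i * g k j))
    - 5 * (n k * contr (fun i j => X i * X j) - X k * contr (fun i j => n i * X j))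
    + contr (fun i j => b k i * X j) - contr (fun i j => b i k * X j)
    + contr (fun i j => X i * b k j) - X k * contr b.
    by rewrite /lhs /contr !sum3E; ring.
  have -> : rhs = M * (chi k * contr g - contr (fun i j => chi i * g k j))
    + 2 * (X k * contr (fun i j => chi i * X j) - chi k * contr (fun i j => X i * X j))
    + c * (contr (fun i j => X i * g k j) - X k * contr g).
    by rewrite /rhs -/c /contr !sum3E; ring.
  rewrite !contr_g !contr_vg !contr_Xv !contr_vX dotX !bX -/(bX' k) -/D -/a -/c.
  move: (bX' k) => B E1; lra.
(* Contracted with X^k, the vectors X^i b_ik and b_ki X^i give the same number, which is M a by
   hypothesis; this fixes the divergence. *)
have D3 : D = 3 * a.
  have : dot bX' = M * a.
    have -> : dot bX' = dot (fun i => dot (b i)).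
      by rewrite /dot /bX' /dot !sum3E; ring.
    by rewrite (eq_dot bX) /a /dot !sum3E; ring.
  have -> : dot bX' = - M * a + (5 * a - D) * dot X.
    by rewrite (eq_dot step1) /a /dot !sum3E; ring.
  rewrite dotX => E; apply: (mulfI M0); lra.
have {}step1 k : bX' k = - M * n k + 2 * a * X k by rewrite step1 D3; ring.
(* Contraction of the Codazzi equation with X^i. *)
have step2 k j : M * b k j = M * a * g k j + 2 * M * n k * X j - a * X k * X j
    - M * X k * n j - M * chi k * X j + c * X k * X j.
  have := eq_dot (fun i => codazzi k i j).
  set lhs := dot _; set rhs := dot _.
  have -> : lhs = M * (n k * dot (fun i => g i j) - g k j * dot n)
    - 5 * (n k * dot X - X k * dot n) * X j + (dot (b k) - bX' k) * X j
    + dot X * b k j - X k * bX' j.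
    by rewrite /lhs /bX' /dot !sum3E; ring.
  have -> : rhs = M * (chi k * dot (fun i => g i j) - dot chi * g k j)
    + 2 * (dot chi * X k - chi k * dot X) * X j
    + c * (g k j * dot X - dot (fun i => g i j) * X k).
    by rewrite /rhs /c /dot !sum3E; ring.
  rewrite dot_g dotX bX !step1 -/a -/c => E1; lra.
(* Contraction of the formula for b with X^j, whose left side is known from |X|^2 = M: n and chi
   differ only along X. This eliminates n. *)
have step3 k : M * n k = M * chi k + (a - c) * X k.
  have : M * dot (b k) = M * a * dot (fun j => g j k) + 2 * M * n k * dot X - a * X k
    * dot X
    - M * X k * dot n - M * chi k * dot X + c * X k * dot X.
    rewrite {1}/dot mulr_sumr; under eq_bigr => j _ do rewrite mulrCA step2 (gC k).
    by rewrite /a /dot !sum3E; ring.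
  rewrite bX dot_g dotX -/a => E; apply: (mulfI M0); lra.
move=> k j; apply: (mulfI M0); rewrite step2.
have := step3 k; have := step3 j => Ej Ek.
have E1 : M * n k * X j = (M * chi k + (a - c) * X k) * X j by rewrite Ek.
have E2 : M * X k * n j = X k * (M * chi j + (a - c) * X j) by rewrite -Ej; ring.
rewrite E2 -[2 * M * n k * X j]/((2 * M) * n k * X j).
have -> : 2 * M * n k * X j = 2 * (M * n k * X j) by ring.
by rewrite E1; ring.
Qed.

(** Contraction with g^ij gives 3 q_k = q_k. It is applied to q = d phi - phi dU. *)
Lemma proportional_metric (q : 'I_3 -> F) :
  (forall k i j, q k * g i j = q i * g k j) -> forall k, q k = 0.
Proof.
move=> qg k; have : q k * contr g = contr (fun i j => q i * g k j).
  rewrite /contr mulr_sumr; apply: eq_bigr => i _.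
  by rewrite mulr_sumr; apply: eq_bigr => j _; rewrite mulrCA qg.
rewrite contr_g contr_vg => E; lra.
Qed.

End conformal_killing.
End three_dimensional_algebra.

(** * Static metrics of type D *)

Lemma addmxE (K : pzRingType) p n (A B : 'M[K]_(p, n)) i j : (A + B) i j = A i j + B
  i j.
Proof. by rewrite mxE. Qed.

Lemma oppmxE (K : pzRingType) p n (A : 'M[K]_(p, n)) i j : (- A) i j = - A i j.
Proof. by rewrite mxE. Qed.

Lemma scalemxE (K : pzRingType) p n c (A : 'M[K]_(p, n)) i j : (c *: A) i j = c * A i j.
Proof. by rewrite mxE. Qed.

Lemma outerE (K : pzRingType) n (v w : 'cV[K]_n) i j : (v *m w^T) i j = v i 0 * w j 0.
Proof. by rewrite mxE big_ord1 mxE. Qed.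

Section static_type_D.
#[local] Opaque pd christoffel conn riem.
Context {R : realType}.
Variables (W : set 'rV[R]_3) (g : 'rV[R]_3 -> 'M[R]_3).
Hypothesis gW : metric_on W g.
Implicit Types (x : 'rV[R]_3).
Let oW : open W. Proof. by case: gW. Qed.
Let sg : smooth_mx W g. Proof. by case: gW. Qed.
Let gT x : W x -> (g x)^T = g x. Proof. by case: gW => _ _ + _; apply. Qed.
Let gC x i j : W x -> g x i j = g x j i.
Proof. by move=> /gT {1}<-; rewrite mxE. Qed.
Let giC x i j : W x -> invmx (g x) i j = invmx (g x) j i.
Proof. by move=> Wx; rewrite -{1}(metric_inv_tr gW Wx) mxE. Qed.
Let ricciC x i j : W x -> ricci g x i j = ricci g x j i.
Proof. by move=> Wx; rewrite -{1}(ricci_tr gW Wx) mxE. Qed.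

(** In dimension three the Weyl tensor vanishes, and with zero scalar curvature only Ricci terms are
    left. *)
Lemma riem3E k i p l x : W x -> trR g x = 0 ->
  riem g k i x p l = - (g x k p * ricci_endo g x i l + (i == l)%:R * ricci g x k p
    - (k == l)%:R * ricci g x i p - g x i p * ricci_endo g x k l).
Proof.
(* Raising p turns the antisymmetry of the lowered curvature into that of [t] in its last two
   indices, as [curvature3_contraction] requires. *)
move=> Wx tr0; pose t k i j l := (invmx (g x) *m riem g k i x) j l.
have a1 k' i' j' l' : t k' i' j' l' = - t i' k' j' l'.
  by rewrite /t riemC mulmxN mxE.
have a2 k' i' j' l' : t k' i' j' l' = - t k' i' l' j'.
  have /(congr1 (fun A => invmx (g x) *m A *m invmx (g x))) := riem_antisym gW k' i' Wx.
  rewrite mulmxDr mulmxDl trmx_mul gT// !mulmxA mulVmx ?(metric_unit gW)// mul1mx.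
  rewrite (mulmxK (metric_unit gW Wx)) mulmx0 mul0mx => /matrixP/(_ j' l').
  rewrite [LHS]mxE [RHS]mxE => /eqP; rewrite addr_eq0 => /eqP.
  rewrite /t => ->; congr (- _).
  by rewrite -[in LHS](metric_inv_tr gW Wx) -trmx_mul mxE.
have r i' l' : \sum_k' t k' i' k' l' = - ricci_endo g x i' l'.
  under eq_bigr do rewrite a2; rewrite sumrN; congr (- _).
  rewrite /t; under eq_bigr do rewrite mxE; rewrite exchange_big mxE/=.
  apply: eq_bigr => p' _; rewrite -mulr_sumr mulrC; congr (_ * _); last exact: giC.
  by rewrite ricciC// (ricciE gW)//.
have tr : \sum_i' - ricci_endo g x i' i' = 0.
  by rewrite sumrN -[\sum_i _]/(trR g x) tr0 oppr0.
have tE := curvature3_contraction a1 a2 r tr.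
have -> : riem g k i x p l = \sum_j g x p j * t k i j l.
  by rewrite -{1}[riem g k i x](mulKVmx (metric_unit gW Wx)) mxE.
under eq_bigr do rewrite tE.
have Rg i' : \sum_j ricci_endo g x i' j * g x p j = ricci g x i' p.
  rewrite -[in RHS](mulmxKV (metric_unit gW Wx) (ricci g x)) mxE.
  by apply: eq_bigr => j _; rewrite (gC p j).
have del i' c : \sum_j g x p j * ((i' == j)%:R * c) = g x i' p * c.
  rewrite (bigD1 i')//= eqxx mul1r big1 ?addr0 ?(gC p i')// => j /negPf.
  by rewrite eq_sym => ->; rewrite mul0r mulr0.
transitivity (- (\sum_j g x p j * ((k == j)%:R * ricci_endo g x i l))
    - (i == l)%:R * (\sum_j ricci_endo g x k j * g x p j)
    + (k == l)%:R * (\sum_j ricci_endo g x i j * g x p j)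
    + \sum_j g x p j * ((i == j)%:R * ricci_endo g x k l)).
  rewrite !mulr_sumr -!sumrN -!big_split/=; apply: eq_bigr => j _.
  move: (ricci_endo g x k j) (ricci_endo g x i j) (ricci_endo g x i l) (ricci_endo g
    x k l).
  by move: (g x p j) => *; ring.
rewrite !del !Rg; move: (ricci_endo g x i l) (ricci_endo g x k l) (ricci g x k p)
  (ricci g x i p).
by move: (g x k p) (g x i p) => *; ring.
Qed.

Variables (U : 'rV[R]_3 -> R).
Hypothesis sU : smooth_on W U.
Hypothesis tr0 : forall x, W x -> trR g x = 0.
Hypothesis hessU : forall x, W x ->
  hessian g U x = ricci g x - (grad U x)^T *m grad U x.

Let chi x : 'cV[R]_3 := (grad U x)^T.
Let schi : smooth_mx W chi. Proof. by apply: smooth_mx_tr; exact: smooth_grad. Qed.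
(** By the static equation this is the Hessian of U, so that the covariant derivative of chi is
    given by algebraic quantities. *)
Let B x := ricci g x - chi x *m (chi x)^T.
Let sB : smooth_mx W B.
Proof.
apply: smooth_mxB => //; first exact: smooth_ricci.
by apply: smooth_mxM => //; exact: smooth_mx_tr.
Qed.

Let cov1_chi i x : W x -> cov1 g i chi x = (row i (B x))^T.
Proof.
move=> Wx; apply/colP => j.
have := hessU Wx => /matrixP/(_ i j).
rewrite /B /chi trmxK ![(row _ _)^T _ _]mxE [in X in _ -> _ = X]mxE => <-.
rewrite cov1E /hessian !mxE; congr (_ - _).
  by congr (pd i _ x); apply/funext => y; rewrite !mxE.
by apply: eq_bigr => k _; rewrite connE /chi !mxE.
Qed.

Lemma riem_contract (v : 'cV[R]_3) k i j x : W x ->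
  - (riem g k i x *m v) j 0 =
  g x k j * (ricci_endo g x *m v) i 0 + v i 0 * ricci g x k j
  - v k 0 * ricci g x i j - g x i j * (ricci_endo g x *m v) k 0.
Proof.
move=> Wx; rewrite [in LHS]mxE.
have E l : riem g k i x j l = _ := riem3E k i j l Wx (tr0 Wx).
under eq_bigr do rewrite E.
have del a c : \sum_l (a == l)%:R * (c * v l 0) = c * v a 0.
  rewrite (bigD1 a)//= eqxx mul1r big1 ?addr0// => l /negPf.
  by rewrite eq_sym => ->; rewrite mul0r.
transitivity (g x k j * (\sum_l ricci_endo g x i l * v l 0)
   + (\sum_l (i == l)%:R * (ricci g x k j * v l 0))
   - (\sum_l (k == l)%:R * (ricci g x i j * v l 0))
   - g x i j * (\sum_l ricci_endo g x k l * v l 0)).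
  rewrite !mulr_sumr -!sumrN -!big_split/=; apply: eq_bigr => l _.
  move: (ricci_endo g x i l) (ricci_endo g x k l) (ricci g x k j) (ricci g x i j).
  by move: (g x k j) (g x i j) (v l 0) => *; ring.
rewrite !del [(ricci_endo g x *m v) i 0]mxE [(ricci_endo g x *m v) k 0]mxE.
by rewrite [ricci g x k j * _]mulrC [ricci g x i j * _]mulrC.
Qed.

#[local] Opaque ricci.

Let BE a b x : B x a b = ricci g x a b - chi x a 0 * chi x b 0.
Proof. by rewrite /B addmxE oppmxE outerE. Qed.

(** The Ricci identity for chi, with [B] as its covariant derivative. The factors 2 arise because
    the curvature term and the derivative of chi (x) chi contribute equally; the terms cubic in chi
    cancel. *)
Lemma static_codazzi k i j x : W x ->
  cov2 g k (ricci g) x i j - cov2 g i (ricci g) x k j =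
  2 * chi x i 0 * ricci g x k j - 2 * chi x k 0 * ricci g x i j
  + g x k j * (ricci_endo g x *m chi x) i 0 - g x i j * (ricci_endo g x *m chi x) k 0.
Proof.
move=> Wx.
have cB a b : cov2 g a B x b j = cov2 g a (ricci g) x b j
    - ((ricci g x a b - chi x a 0 * chi x b 0) * chi x j 0
       + chi x b 0 * (ricci g x a j - chi x a 0 * chi x j 0)).
  have -> : cov2 g a B x = cov2 g a (ricci g) x
      - cov2 g a (fun y => chi y *m (chi y)^T) x.
    apply: (@cov2B _ _ W) => //; first exact: (smooth_ricci gW).
    by apply: smooth_mxM => //; exact: smooth_mx_tr.
  rewrite (cov2_outer g _ schi schi Wx) (cov1_chi a Wx) addmxE oppmxE addmxE.
  by rewrite !outerE -!BE ![(row _ _)^T _ _]mxE ![row _ _ _ _]mxE.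
have alg (c1 c2 rki rik rkj rij ci cj ck a b u v : R) : rik = rki ->
    c1 - ((rki - ck * ci) * cj + ci * (rkj - ck * cj)) -
    (c2 - ((rik - ci * ck) * cj + ck * (rij - ci * cj))) =
    a * u + ci * rkj - ck * rij - b * v ->
    c1 - c2 = 2 * ci * rkj - 2 * ck * rij + a * u - b * v by move=> -> ?; lra.
apply: alg (ricciC i k Wx) _; rewrite -riem_contract//.
apply: etrans (ricci_identity gW k i j schi cov1_chi Wx).
exact: (congr2 (fun a b : R => a - b) (esym (cB k i)) (esym (cB i k))).
Qed.

Variables (mu m : 'rV[R]_3 -> R) (X : 'rV[R]_3 -> 'cV[R]_3).
Hypotheses (smu : smooth_on W mu) (sm : smooth_on W m) (sX : smooth_mx W X).
Hypothesis m0 : forall x, W x -> m x != 0.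
Hypothesis mu_m : forall x, W x -> mu x ^+ 2 * m x ^+ 6 = 1.
Hypothesis ricX : forall x, W x ->
  ricci g x = mu x *: g x - (3 * mu x / m x ^+ 2) *: (X x *m (X x)^T).
Hypothesis normX : forall x, W x ->
  ((X x)^T *m invmx (g x) *m X x) 0 0 = m x ^+ 2.

Let dm x : W x -> differentiable m x.
Proof. by move=> Wx; exact: smooth_on_differentiable Wx. Qed.

Let dmu x : W x -> differentiable mu x.
Proof. by move=> Wx; exact: smooth_on_differentiable Wx. Qed.

(** The logarithmic derivative of mu^2 m^6 = 1, a form of m = |mu|^(-1/3) that does not see the sign
    of mu. *)
Lemma pd_mu k x : W x -> pd k mu x = - 3 * mu x * (pd k m x / m x).
Proof.
move=> Wx; have := dm Wx; have := dmu Wx; have := m0 Wx => mx0 dmu' dm'.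
have E : pd k (fun y => mu y ^+ 2 * m y ^+ 6) x = 0.
  by rewrite (@pd_eq_on _ _ W _ _ (fun=> 1))// pd_cst.
have mu0 : mu x != 0.
  by apply/eqP => z; have := mu_m Wx; rewrite z expr0n mul0r => /esym/eqP; rewrite
    oner_eq0.
have dX (f : 'rV[R]_3 -> R) n : differentiable f x -> differentiable (fun y => f y ^+
  n.+1) x.
  exact: differentiable_exprn.
have pX (f : 'rV[R]_3 -> R) n : differentiable f x -> pd k (fun y => f y ^+ n.+1) x =
  n.+1%:R * f x ^+ n * pd k f x.
  by move=> df; exact: pdX.
have := E; rewrite (pdM k (dX mu 1%N dmu') (dX m 5%N dm')) !pX//.
move: (pd k mu x) (pd k m x) (mu x) (m x) mu0 mx0 => a b u v u0 v0 E1.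
have nz : 2 * u * v ^+ 5 != 0.
  by apply: mulf_neq0; [apply: mulf_neq0 => //; rewrite pnatr_eq0|exact: expf_neq0].
have E2 : v * a + 3 * u * b = 0 by apply: (mulfI nz); rewrite mulr0 -[RHS]E1; ring.
apply: (mulfI v0); have -> : v * a = - (3 * u * b) by lra.
by field.
Qed.

(** The coefficient of X (x) X in the Ricci tensor. Up to a constant it is the power -5 of m, which
    is the origin of the factors 5 below. *)
Let q x := 3 * mu x * (m x)^-1 ^+ 2.
Let sq : smooth_on W q.
Proof.
apply: smooth_onM => //; first by apply: smooth_onM => //; exact: smooth_on_cst.
by under eq_fun do rewrite expr2; apply: smooth_onM => //; exact: smooth_onV.
Qed.

Let pd_q k x : W x -> pd k q x = - 5 * q x * (pd k m x / m x).
Proof.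
move=> Wx; have dq := smooth_on_differentiable sq Wx.
have E : pd k (fun y => q y * m y ^+ 2) x = pd k (fun y => 3 * mu y) x.
  apply: (pd_eq_on _ oW) Wx => y Wy; rewrite /q; field; exact: m0.
have dm2 : differentiable (fun y => m y ^+ 2) x by apply: differentiable_exprn;
  exact: dm.
move: E; rewrite (pdM k dq dm2) (pdX k 1 (dm Wx)) (pdZ _ _ (dmu Wx)) pd_mu//.
have -> : mu x = q x * m x ^+ 2 / 3 by rewrite /q; field; exact: m0.
move: (pd k q x) (pd k m x) (q x) (m x) (m0 Wx) => a b u v v0 E.
have v20 : v ^+ 2 != 0 by rewrite expf_neq0.
apply: (mulIf v20); rewrite -[LHS](addrK (u * (2 * v ^+ 1 * b))) E; field; exact: v0.
Qed.

Let ricXq x : W x -> ricci g x = mu x *: g x - q x *: (X x *m (X x)^T).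
Proof. by move=> Wx; rewrite ricX// /q exprVn. Qed.

Let b k i x := cov1 g k X x i 0.
Let n k x := pd k m x / m x.

Let ricciXE i j x : W x ->
  ricci g x i j = mu x * g x i j - q x * (X x i 0 * X x j 0).
Proof.
by move=> Wx; rewrite ricXq// addmxE oppmxE !scalemxE outerE.
Qed.

Let cov2_ricci k i j x : W x -> cov2 g k (ricci g) x i j =
  - 3 * mu x * n k x * g x i j
  - (- 5 * q x * n k x * (X x i 0 * X x j 0) + q x * (b k i x * X x j 0 + X x i 0 * b
    k j x)).
Proof.
move=> Wx; have sXX : smooth_mx W (fun y => X y *m (X y)^T).
  by apply: smooth_mxM => //; exact: smooth_mx_tr.
have -> : cov2 g k (ricci g) x =
    pd k mu x *: g x - (pd k q x *: (X x *m (X x)^T) + q x *: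
     (cov1 g k X x *m (X x)^T + X x *m (cov1 g k X x)^T)).
  transitivity (cov2 g k (fun y => mu y *: g y - q y *: (X y *m (X y)^T)) x).
    exact: cov2_eq_on Wx.
  rewrite (@cov2B _ _ W)//; [|exact: smooth_mxZ..].
  rewrite (@cov2Z _ _ W)// (@cov2Z _ _ W)// (cov2_metric gW)// scaler0 addr0.
  by rewrite (@cov2_outer _ _ W).
by rewrite pd_mu// pd_q// addmxE oppmxE addmxE !scalemxE addmxE !outerE.
Qed.

(** The vector X^i, used to contract covectors with X. *)
Let chiu x i := \sum_j invmx (g x) i j * X x j 0.

Let ricci_endoE (v : 'cV[R]_3) i x : W x -> (ricci_endo g x *m v) i 0 =
  mu x * v i 0 - q x * X x i 0 * ((X x)^T *m invmx (g x) *m v) 0 0.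
Proof.
move=> Wx; rewrite /ricci_endo ricXq// mulmxBl -!scalemxAl (mulmxV (metric_unit gW Wx)).
rewrite mulmxBl -!scalemxAl mul1mx -!mulmxA addmxE oppmxE !scalemxE.
by rewrite [X in _ - _ * X]mxE big_ord1 mulrA !mulmxA.
Qed.

Let dotE (v : 'cV[R]_3) x : W x -> ((X x)^T *m invmx (g x) *m v) 0 0 =
  \sum_i chiu x i * v i 0.
Proof.
move=> Wx; rewrite mxE; apply: eq_bigr => i _; congr (_ * _).
by rewrite mxE; apply: eq_bigr => j _; rewrite mxE mulrC giC.
Qed.

(** This is the derivative of |X|^2 = m^2. *)
Let dot_b k x : W x -> \sum_i chiu x i * b k i x = m x ^+ 2 * n k x.
Proof.
move=> Wx; rewrite -(dotE (cov1 g k X x) Wx).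
have := pd_inner_inv gW k sX sX Wx.
have -> : pd k (fun y => ((X y)^T *m invmx (g y) *m X y) 0 0) x = pd k (fun y => m y
  ^+ 2) x.
  by apply: (pd_eq_on _ oW) Wx => y; exact: normX.
rewrite (pdX k 1 (dm Wx)) addmxE.
have -> : ((cov1 g k X x)^T *m invmx (g x) *m X x) 0 0 =
  ((X x)^T *m invmx (g x) *m cov1 g k X x) 0 0.
  have sc (A : 'M[R]_1) : A 0 0 = A^T 0 0 by rewrite mxE.
  by rewrite sc !trmx_mul trmxK mulmxA (metric_inv_tr gW Wx).
move=> E; have mx0 := m0 Wx; rewrite /n; move: E.
move: (_ 0 0) (pd k m x) (m x) mx0 => u p v v0 E.
have -> : v ^+ 2 * (p / v) = v * p by field.
lra.
Qed.

(* The derivative of m along the unit vector dual to X / m. *)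
Definition flux x : R := ((X x)^T *m invmx (g x) *m (grad m x)^T) 0 0 / m x.

Lemma fluxE x : W x -> flux x = \sum_i chiu x i * n i x.
Proof.
move=> Wx; rewrite /flux dotE// mulr_suml; apply: eq_bigr => i _.
by rewrite -mulrA; congr (_ * (_ / _)); rewrite !mxE.
Qed.

Lemma conformal_killing k j x : W x -> cov1 g k X x j 0 =
  flux x * g x k j + chi x k 0 * X x j 0 - X x k 0 * chi x j 0.
Proof.
move=> Wx; rewrite fluxE//.
have gig i j' : \sum_k invmx (g x) i k * g x k j' = (i == j')%:R.
  have /matrixP/(_ i j') := mulVmx (metric_unit gW Wx).
  by rewrite [LHS]mxE [RHS]mxE.
have M0 : m x ^+ 2 != 0 by rewrite expf_neq0// m0.
have dX : \sum_i chiu x i * X x i 0 = m x ^+ 2 by rewrite -dotE// normX.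
apply: (@conformal_killing_algebra R (fun i j => g x i j) (fun i j => invmx (g x) i j)
  (fun i => X x i 0) (fun i => chi x i 0) (n ^~ x) (fun k i => b k i x) (m x ^+ 2))
    => //.
- by move=> i j'; exact: giC.
- by move=> i j'; exact: gC.
- by move=> k'; exact: dot_b.
(* Division of the Codazzi equation by the coefficient v = [q], after eliminating u = mu through v N
   = 3 u, where N = m^2. *)
have alg (u v N nk ni gij gkj Xi Xj Xk bki bik bkj bij ci ck c : R) : v != 0 -> v * N
  = 3 * u ->
    - 3 * u * nk * gij - (- 5 * v * nk * (Xi * Xj) + v * (bki * Xj + Xi * bkj))
    - (- 3 * u * ni * gkj - (- 5 * v * ni * (Xk * Xj) + v * (bik * Xj + Xk * bij))) =
    2 * ci * (u * gkj - v * (Xk * Xj)) - 2 * ck * (u * gij - v * (Xi * Xj))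
    + gkj * (u * ci - v * Xi * c) - gij * (u * ck - v * Xk * c) ->
    N * (nk * gij - ni * gkj) - 5 * (nk * Xi - ni * Xk) * Xj + (bki - bik) * Xj
     + Xi * bkj - Xk * bij =
     N * (ck * gij - ci * gkj) + 2 * (ci * Xk - ck * Xi) * Xj + c * (gkj * Xi - gij *
       Xk).
  move=> v0 vN; have {vN} -> : u = v * N / 3 by rewrite vN; field.
  by move=> H; apply: (mulfI v0); lra.
move=> k' i j'; apply: (alg (mu x) (q x)).
- rewrite /q mulf_neq0 ?expf_neq0 ?invr_neq0 ?m0// mulf_neq0 ?pnatr_eq0//.
  apply/eqP => z; have := mu_m Wx; rewrite z expr0n mul0r => /esym/eqP.
  by rewrite oner_eq0.
- by rewrite /q; field; exact: m0.
apply: etrans (congr2 (fun a b : R => a - b) (esym (cov2_ricci k' i j' Wx))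
                                             (esym (cov2_ricci i k' j' Wx))) _.
apply: etrans (static_codazzi k' i j' Wx) _.
by rewrite (ricciXE k' j' Wx) (ricciXE i j' Wx) (ricci_endoE (chi x) i Wx)
  (ricci_endoE (chi x) k' Wx) (dotE (chi x) Wx).
Qed.

Let sflux : smooth_on W flux.
Proof.
apply: smooth_onM => //; last exact: smooth_onV.
apply: (smooth_mxM oW (smooth_mxM oW (smooth_mx_tr sX) (smooth_metric_inv gW))).
exact: smooth_mx_tr (smooth_grad sm).
Qed.

(** The conformal Killing equation gives the derivative [BX] of X, to which the Ricci identity is
    applied. Since X is an eigenvector of R and the curvature is expressed by R, everything cancels
    except the terms in p = d phi - phi dU, leaving p_k g_ij = p_i g_kj. *)
Lemma pd_flux k x : W x -> pd k flux x = flux x * pd k U x.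
Proof.
move=> Wx; pose BX y := flux y *: g y + (chi y *m (X y)^T - X y *m (chi y)^T).
have s1 : smooth_mx W (fun y => chi y *m (X y)^T).
  by apply: smooth_mxM => //; exact: smooth_mx_tr.
have s2 : smooth_mx W (fun y => X y *m (chi y)^T).
  by apply: smooth_mxM => //; exact: smooth_mx_tr.
have BXE k' j y : W y -> cov1 g k' X y j 0 = BX y k' j.
  by move=> Wy; rewrite conformal_killing// /BX !addmxE oppmxE scalemxE !outerE addrA.
have cX k' y : W y -> cov1 g k' X y = (row k' (BX y))^T.
  by move=> Wy; apply/colP => j; rewrite BXE// [RHS]mxE [RHS]mxE.
have cBX a c j : cov2 g a BX x c j = pd a flux x * g x c j
    + ((ricci g x a c - chi x a 0 * chi x c 0) * X x j 0 + chi x c 0 * b a j x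
       - (b a c x * chi x j 0 + X x c 0 * (ricci g x a j - chi x a 0 * chi x j 0))).
  have -> : cov2 g a BX x = pd a flux x *: g x +
    ((cov1 g a chi x *m (X x)^T + chi x *m (cov1 g a X x)^T) -
     (cov1 g a X x *m (chi x)^T + X x *m (cov1 g a chi x)^T)).
    rewrite (@cov2D _ _ W)//; [|exact: smooth_mxZ|exact: smooth_mxB].
    rewrite (@cov2Z _ _ W)// (cov2_metric gW)// scaler0 addr0.
    by rewrite (@cov2B _ _ W)// !(@cov2_outer _ _ W).
  rewrite !addmxE oppmxE addmxE scalemxE !outerE (cov1_chi a Wx).
  by rewrite ![(row _ _)^T _ _]mxE ![row _ _ _ _]mxE !BE.
pose p c := pd c flux x - flux x * chi x c 0.
suff p0 : p k = 0 by move/eqP: p0; rewrite /p subr_eq0 => /eqP ->; rewrite /chi !mxE.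
have gig i j' : \sum_k invmx (g x) i k * g x k j' = (i == j')%:R.
  have /matrixP/(_ i j') := mulVmx (metric_unit gW Wx).
  by rewrite [LHS]mxE [RHS]mxE.
apply: (@proportional_metric R (fun i j => g x i j) (fun i j => invmx (g x) i j)) => //.
  by move=> i j'; exact: gC.
move=> k' i j; rewrite /p.
have alg (pk pi f gij gkj ci cj ck Xi Xj Xk bkj bij bki bik u v N rki rik rkj rij : R) :
    bkj = f * gkj + ck * Xj - Xk * cj -> bij = f * gij + ci * Xj - Xi * cj ->
    bki - bik = 2 * (ck * Xi - Xk * ci) -> rik = rki -> v * N = 3 * u ->
    rkj = u * gkj - v * (Xk * Xj) -> rij = u * gij - v * (Xi * Xj) ->
    pk * gij + ((rki - ck * ci) * Xj + ci * bkj - (bki * cj + Xi * (rkj - ck * cj)))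
    - (pi * gkj + ((rik - ci * ck) * Xj + ck * bij - (bik * cj + Xk * (rij - ci *
      cj)))) =
    gkj * (u * Xi - v * Xi * N) + Xi * rkj - Xk * rij - gij * (u * Xk - v * Xk * N) ->
    (pk - f * ck) * gij = (pi - f * ci) * gkj.
  move=> -> -> Eb -> vN -> ->; have {vN} -> : u = v * N / 3 by rewrite vN; field.
  have -> : bik = bki - 2 * (ck * Xi - Xk * ci) by rewrite -Eb; ring.
  by move=> H; lra.
apply: (alg _ _ _ _ _ _ _ _ (X x i 0) (X x j 0) (X x k' 0) _ _ (b k' i x) (b i k' x)
  (mu x) (q x)
  (m x ^+ 2) _ _ _ _ (conformal_killing k' j Wx) (conformal_killing i j Wx) _
  (ricciC i k' Wx) _ (ricciXE k' j Wx) (ricciXE i j Wx)).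
- rewrite /b (conformal_killing k' i Wx) (conformal_killing i k' Wx) (gC i k' Wx).
  by move: (chi x k' 0) (chi x i 0) (X x k' 0) (X x i 0) (flux x) (g x k' i) => *; ring.
- by rewrite /q; field; exact: m0.
apply: etrans (congr2 (fun a b : R => a - b) (esym (cBX k' i j)) (esym (cBX i k' j))) _.
apply: etrans (ricci_identity gW k' i j sX cX Wx) _.
rewrite (riem_contract _ _ _ _ Wx) (ricci_endoE (X x) i Wx) (ricci_endoE (X x) k' Wx).
by rewrite (normX Wx).
Qed.

End static_type_D.

(** * The Ricci tensor of a static metric *)

Section static_metric.
#[local] Opaque pd conn.
Context {R : realType} {n : nat}.
Variables (W : set 'rV[R]_n) (g : 'rV[R]_n -> 'M[R]_n) (U : 'rV[R]_n -> R).
Hypotheses (gW : metric_on W g) (sU : smooth_on W U).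
Let oW : open W. Proof. by case: gW. Qed.
Let sg : smooth_mx W g. Proof. by case: gW. Qed.
Let dU x : W x -> differentiable U x.
Proof. by move=> Wx; exact: smooth_on_differentiable Wx. Qed.

Local Notation H := (static_metric g U).
Local Notation z := (lshift n (0 : 'I_1)).
Local Notation r := (rshift 1).
Let D : set 'rV[R]_(1 + n) := [set y | W (rsubmx y)].

Let oD : open D.
Proof.
apply: (@open_comp _ _ (fun y : 'rV[R]_(1 + n) => rsubmx y)) oW => y _.
exact/differentiable_continuous/differentiable_rsubmx.
Qed.

Let pd_r i F f y : (forall y, D y -> F y = f (rsubmx y)) -> D y ->
  pd (r i) F y = pd i f (rsubmx y).
Proof. by move=> Ff Dy; rewrite (pd_eq_on _ oD Ff Dy) pd_rsubmx. Qed.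

Let pd_z F f y : (forall y, D y -> F y = f (rsubmx y)) -> D y -> pd z F y = 0.
Proof. by move=> Ff Dy; rewrite (pd_eq_on _ oD Ff Dy) pd_rsubmx0. Qed.

Lemma static_metric_inv y : D y -> invmx (H y) =
  block_mx (- expR (- 2 * U (rsubmx y)))%:M 0 0 (invmx (g (rsubmx y))).
Proof.
move=> Dy; set K := block_mx _ _ _ _.
have HK : H y *m K = 1%:M.
  rewrite /static_metric mulmx_block !mulmx0 !mul0mx !addr0 !add0r.
  rewrite (mulmxV (metric_unit gW Dy)) -scalar_mxM mulrNN -expRD.
  by rewrite mulNr subrr expR0 -scalar_mx_block.
have [uH _] := mulmx1_unit HK.
by rewrite -[LHS]mulmx1 -HK mulKmx.
Qed.

Let Hzz y : H y z z = - expR (2 * U (rsubmx y)).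
Proof. by rewrite /static_metric block_mxEul mxE eqxx. Qed.
Let Hzr y i : H y z (r i) = 0. Proof. by rewrite /static_metric block_mxEur mxE. Qed.
Let Hrz y i : H y (r i) z = 0. Proof. by rewrite /static_metric block_mxEdl mxE. Qed.
Let Hrr y i j : H y (r i) (r j) = g (rsubmx y) i j.
Proof. by rewrite /static_metric block_mxEdr. Qed.

Let Kzz y : D y -> invmx (H y) z z = - expR (- 2 * U (rsubmx y)).
Proof. by move=> Dy; rewrite static_metric_inv// block_mxEul mxE eqxx. Qed.
Let Kzr y i : D y -> invmx (H y) z (r i) = 0.
Proof. by move=> Dy; rewrite static_metric_inv// block_mxEur mxE. Qed.
Let Krz y i : D y -> invmx (H y) (r i) z = 0.
Proof. by move=> Dy; rewrite static_metric_inv// block_mxEdl mxE. Qed.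
Let Krr y i j : D y -> invmx (H y) (r i) (r j) = invmx (g (rsubmx y)) i j.
Proof. by move=> Dy; rewrite static_metric_inv// block_mxEdr. Qed.

Let pdz_H a b y : D y -> pd z (fun y => H y a b) y = 0.
Proof.
move=> Dy; apply: (@pd_z _ (fun x => H (row_mx 0 x) a b)) Dy => y' _.
by rewrite /static_metric row_mxKr.
Qed.
Let pdr_Hzz i y : D y ->
  pd (r i) (fun y => H y z z) y = - (2 * expR (2 * U (rsubmx y)) * pd i U (rsubmx y)).
Proof.
move=> Dy; rewrite (@pd_r _ _ (fun x => - expR (2 * U x)))//.
have d2U : differentiable (fun x => 2 * U x) (rsubmx y).
  by apply: differentiableM => //; exact: dU.
have [de E] := pd_comp i (is_derive_expR (2 * U (rsubmx y))) d2U.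
by rewrite pdN// E pdZ; [ring|exact: dU].
Qed.
Let pdr_Hzr i j y : D y -> pd (r i) (fun y => H y z (r j)) y = 0.
Proof. by move=> Dy; rewrite (@pd_r _ _ (fun x => 0))// pd_cst. Qed.
Let pdr_Hrz i j y : D y -> pd (r i) (fun y => H y (r j) z) y = 0.
Proof. by move=> Dy; rewrite (@pd_r _ _ (fun x => 0))// pd_cst. Qed.
Let pdr_Hrr i j k y : D y ->
  pd (r i) (fun y => H y (r j) (r k)) y = pd i (fun x => g x j k) (rsubmx y).
Proof. by move=> Dy; rewrite (@pd_r _ _ (fun x => g x j k)). Qed.

Let split_sum (F : 'I_(1 + n) -> R) : \sum_k F k = F z + \sum_k F (r k).
Proof. by rewrite big_split_ord/= big_ord1. Qed.

Let simp y (Dy : D y) := (Kzz Dy, fun i => Kzr i Dy, fun i => Krz i Dy,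
  fun i j => Krr i j Dy, fun a b => pdz_H a b Dy, fun i => pdr_Hzz i Dy,
  fun i j => pdr_Hzr i j Dy, fun i j => pdr_Hrz i j Dy, fun i j k => pdr_Hrr i j k Dy).

Definition raise_grad k x : R := \sum_l invmx (g x) k l * pd l U x.

(** The nonzero symbols with time indices have exactly two of them: d_i U when one is the upper
    index, and e^(2U) times the raised gradient when both are lower. The purely spatial symbols are
    those of g. *)
Let Gzzz y : D y -> christoffel H z z z y = 0.
Proof.
move=> Dy; rewrite /christoffel split_sum !(simp Dy) !addr0 subrr mulr0 add0r.
by rewrite big1 ?mulr0// => l _; rewrite !(simp Dy) mul0r.
Qed.
Let Gzzr i y : D y -> christoffel H z z (r i) y = pd i U (rsubmx y).
Proof.
move=> Dy; rewrite /christoffel split_sum big1 => [|l _]; last by rewrite !(simp Dy)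
  mul0r.
rewrite !(simp Dy) addr0 subr0 add0r mulrNN mulrA -!mulrA [expR _ * (2 * _)]mulrCA.
by rewrite mulKf ?pnatr_eq0// mulrA -expRD mulNr addNr expR0 mul1r.
Qed.
Let Gzrz i y : D y -> christoffel H z (r i) z y = pd i U (rsubmx y).
Proof.
move=> Dy; rewrite /christoffel split_sum big1 => [|l _]; last by rewrite !(simp Dy)
  mul0r.
rewrite !(simp Dy) !addr0 subr0 mulrNN mulrA -!mulrA [expR _ * (2 * _)]mulrCA.
by rewrite mulKf ?pnatr_eq0// mulrA -expRD mulNr addNr expR0 mul1r.
Qed.
Let Gzrr i j y : D y -> christoffel H z (r i) (r j) y = 0.
Proof.
move=> Dy; rewrite /christoffel split_sum big1 => [|l _]; last by rewrite !(simp Dy)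
  mul0r.
by rewrite !(simp Dy) !addr0 subr0 !mulr0.
Qed.
Let Grzz k y : D y -> christoffel H (r k) z z y =
  expR (2 * U (rsubmx y)) * raise_grad k (rsubmx y).
Proof.
move=> Dy; rewrite /christoffel split_sum !(simp Dy) mul0r add0r /raise_grad !mulr_sumr.
apply: eq_bigr => l _; rewrite !(simp Dy) add0r sub0r opprK.
by move: (expR _) (invmx _ _ _) (pd _ _ _) => a b c; field.
Qed.
Let Grzr k i y : D y -> christoffel H (r k) z (r i) y = 0.
Proof.
move=> Dy; rewrite /christoffel split_sum !(simp Dy) mul0r add0r.
by rewrite big1 ?mulr0// => l _; rewrite !(simp Dy) addr0 subr0 mulr0.
Qed.
Let Grrz k i y : D y -> christoffel H (r k) (r i) z y = 0.
Proof.
move=> Dy; rewrite /christoffel split_sum !(simp Dy) mul0r add0r.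
by rewrite big1 ?mulr0// => l _; rewrite !(simp Dy) addr0 subr0 mulr0.
Qed.
Let Grrr k i j y : D y -> christoffel H (r k) (r i) (r j) y = christoffel g k i j
  (rsubmx y).
Proof.
move=> Dy; rewrite /christoffel split_sum !(simp Dy) mul0r add0r; congr (_ * _).
by apply: eq_bigr => l _; rewrite !(simp Dy).
Qed.

Let Gs y (Dy : D y) := (Gzzz Dy, fun i => Gzzr i Dy, fun i => Gzrz i Dy,
  fun i j => Gzrr i j Dy, fun k => Grzz k Dy, fun k i => Grzr k i Dy,
  fun k i => Grrz k i Dy, fun k i j => Grrr k i j Dy).

Let split_sum2 (F : 'I_(1 + n) -> 'I_(1 + n) -> R) : \sum_k \sum_l F k l =
  F z z + \sum_l F z (r l) + \sum_k F (r k) z + \sum_k \sum_l F (r k) (r l).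
Proof.
rewrite split_sum split_sum -!addrA; congr (_ + (_ + _)); rewrite -big_split/=.
by apply: eq_bigr => k _; rewrite split_sum.
Qed.

Lemma static_ricci_rr i j y : D y -> ricci H y (r i) (r j) =
  ricci g (rsubmx y) i j - hessian g U (rsubmx y) i j
  - pd i U (rsubmx y) * pd j U (rsubmx y).
Proof.
move=> Dy; set x := rsubmx y.
have lin : \sum_k (pd k (christoffel H k (r i) (r j)) y - pd (r j) (christoffel H k
  (r i) k) y) =
    - pd j (pd i U) x + \sum_k (pd k (christoffel g k i j) x - pd j (christoffel g k
      i k) x).
  rewrite split_sum (@pd_z (christoffel H z (r i) (r j)) (fun=> 0) y (fun y => @Gzrr
    i j y) Dy).
  rewrite (@pd_r j (christoffel H z (r i) z) (pd i U) y (fun y => @Gzrz i y) Dy) sub0r.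
  congr (_ + _); apply: eq_bigr => k _; congr (_ - _).
    exact: (@pd_r k (christoffel H (r k) (r i) (r j)) (christoffel g k i j) y (fun y
      => @Grrr k i j y) Dy).
  exact: (@pd_r j (christoffel H (r k) (r i) (r k)) (christoffel g k i k) y (fun y =>
    @Grrr k i k y) Dy).
have quad : \sum_k \sum_l (christoffel H k k l y * christoffel H l (r i) (r j) y -
     christoffel H k (r j) l y * christoffel H l (r i) k y) =
   - (pd i U x * pd j U x) + \sum_l christoffel g l i j x * pd l U x +
   \sum_k \sum_l (christoffel g k k l x * christoffel g l i j x -
     christoffel g k j l x * christoffel g l i k x).
  rewrite split_sum2 /= [X in _ + X + _]big1 => [|k _]; last first.
    by rewrite !(Gs Dy) !mul0r subrr.
  rewrite addr0; congr (_ + _ + _).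
  - by rewrite !(Gs Dy) mul0r sub0r mulrC.
  - by apply: eq_bigr => l _; rewrite !(Gs Dy) mul0r subr0 mulrC.
  - by apply: eq_bigr => k _; apply: eq_bigr => l _; rewrite !(Gs Dy).
have -> : ricci H y (r i) (r j) = _ := mxE _ _ _ _; rewrite lin quad.
have -> : ricci g x i j = _ := mxE _ _ _ _; have -> : hessian g U x i j = _ := mxE _
  _ _ _.
rewrite (pdC j i oW sU Dy).
have alg (a b c d e : R) : - a + b + (- c + d + e) = b + e - (a - d) - c by ring.
exact: alg.
Qed.

Let no_time (F : 'rV[R]_(1 + n) -> R) y : (forall y, D y -> F y = 0) -> D y ->
  forall a, pd a F y = 0.
Proof. by move=> F0 Dy a; rewrite (pd_eq_on a oD F0 Dy) pd_cst. Qed.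

(** Symbols with an odd number of time indices vanish, as do time derivatives, and each term of a
    mixed component contains one or the other. *)
Lemma static_ricci_zr j y : D y -> ricci H y z (r j) = 0.
Proof.
move=> Dy; have -> : ricci H y z (r j) = _ := mxE _ _ _ _.
rewrite split_sum (pd_z (fun y => @Gzzr j y) Dy) (no_time (fun y => @Gzzz y) Dy).
rewrite big1 => [|k _]; last first.
  by rewrite (no_time (fun y => @Grzr k j y) Dy) (no_time (fun y => @Grzr k k y) Dy)
    subrr.
rewrite split_sum2 /= !(Gs Dy) !big1 => [|k _|k _|k _].
- by rewrite !(mul0r, mulr0, subrr, addr0).
- by rewrite big1// => l _; rewrite !(Gs Dy) !(mul0r, mulr0) subrr.
- by rewrite !(Gs Dy) !(mul0r, mulr0) subrr.
- by rewrite !(Gs Dy) !(mul0r, mulr0) subrr.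
Qed.

Lemma static_ricci_rz j y : D y -> ricci H y (r j) z = 0.
Proof.
move=> Dy; have -> : ricci H y (r j) z = _ := mxE _ _ _ _.
rewrite split_sum (pd_z (fun y => @Gzrz j y) Dy) subrr.
rewrite big1 => [|k _]; last first.
  by rewrite (no_time (fun y => @Grrz k j y) Dy) (pd_z (fun y => @Grrr k j k y) Dy)
    subrr.
rewrite split_sum2 /= !(Gs Dy) !big1 => [|k _|k _|k _].
- by rewrite !(mul0r, mulr0, subrr, addr0).
- by rewrite big1// => l _; rewrite !(Gs Dy) !(mul0r, mulr0) subrr.
- by rewrite !(Gs Dy) !(mul0r, mulr0) subrr.
- by rewrite !(Gs Dy) !(mul0r, mulr0) subrr.
Qed.

(** Two expressions for the Laplacian of U. The derivative of g^-1 produces two Christoffel terms: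
    one cancels that of the divergence ([S3]), the other is that of the Hessian ([S2]). *)
Lemma div_raise_grad x : W x ->
  \sum_k pd k (raise_grad k) x + \sum_k \sum_l christoffel g k k l x * raise_grad l x =
  \tr (invmx (g x) *m hessian g U x).
Proof.
move=> Wx; have sgi := smooth_metric_inv gW.
have sr k l : smooth_on W (fun y => invmx (g y) k l * pd l U y).
  by apply: smooth_onM; [exact: oW|exact: sgi|exact: smooth_on_pd].
have E k : pd k (raise_grad k) x = \sum_l (invmx (g x) k l * pd k (pd l U) x
    - (\sum_p invmx (g x) k p * christoffel g l k p x) * pd l U x
    - (\sum_p invmx (g x) l p * christoffel g k k p x) * pd l U x).
  rewrite pd_sum => [|l]; last exact: smooth_on_differentiable (sr k l) Wx.
  apply: eq_bigr => l _; rewrite pdM; last 2 first.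
  - exact: smooth_on_differentiable (sgi k l) Wx.
  - exact: smooth_on_differentiable (smooth_on_pd l sU) Wx.
  have := pdmx_metric_inv gW k Wx => /matrixP/(_ k l).
  rewrite [LHS]mxE [RHS]mxE => ->.
  rewrite [(_ + _ : 'M[R]_n) k l]mxE [(_ ^T) k l]mxE.
  have Ec a b : (invmx (g x) *m conn g k x) a b =
      \sum_p invmx (g x) a p * christoffel g b k p x.
    by rewrite mxE; apply: eq_bigr => p _; rewrite connE.
  rewrite !Ec.
  by rewrite opprD mulrDl !mulNr addrC addrA.
rewrite -big_split/= /mxtrace; apply: eq_bigr => k _.
rewrite E.
have S3 : \sum_l christoffel g k k l x * raise_grad l x =
    \sum_l (\sum_p invmx (g x) l p * christoffel g k k p x) * pd l U x.
  rewrite /raise_grad; under eq_bigr do rewrite mulr_sumr.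
  rewrite exchange_big/=; apply: eq_bigr => l _; rewrite mulr_suml.
  apply: eq_bigr => p _; have -> : invmx (g x) p l = invmx (g x) l p.
    by rewrite -{1}(metric_inv_tr gW Wx) mxE.
  by rewrite mulrA [christoffel _ _ _ _ _ * _]mulrC.
have S2 : \sum_l (\sum_p invmx (g x) k p * christoffel g l k p x) * pd l U x =
    \sum_p invmx (g x) k p * \sum_l christoffel g l k p x * pd l U x.
  under [RHS]eq_bigr do rewrite mulr_sumr.
  rewrite exchange_big/=; apply: eq_bigr => l _; rewrite mulr_suml.
  apply: eq_bigr => p _. by rewrite -!mulrA.
rewrite S3 !(big_split, sumrN)/= S2 subrK -sumrB mxE.
apply: eq_bigr => l _; rewrite -mulrBr; congr (_ * _).
rewrite [RHS]mxE (pdC l k oW sU Wx); congr (_ - _).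
by apply: eq_bigr => p _; rewrite (christoffelC gW _ _ _ Wx).
Qed.

Lemma static_ricci_zz y : D y -> ricci H y z z = expR (2 * U (rsubmx y)) *
  \tr (invmx (g (rsubmx y)) *m (hessian g U (rsubmx y) + (grad U (rsubmx y))^T *m
    grad U (rsubmx y))).
Proof.
move=> Dy; set x := rsubmx y; have Wx : W x := Dy.
have sgi := smooth_metric_inv gW.
have sraise k : smooth_on W (raise_grad k).
  apply: smooth_on_sum => // l.
  by apply: smooth_onM; [exact: oW|exact: sgi|exact: smooth_on_pd].
have dE k : differentiable (fun x => expR (2 * U x)) x /\
    pd k (fun x => expR (2 * U x)) x = 2 * expR (2 * U x) * pd k U x.
  have d2U : differentiable (fun x => 2 * U x) x by apply: differentiableM => //;
    exact: dU.
  have [de E] := pd_comp k (is_derive_expR (2 * U x)) d2U; split => //.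
  by rewrite E pdZ; [ring|exact: dU].
have nrm : \sum_l pd l U x * raise_grad l x =
    \tr (invmx (g x) *m ((grad U x)^T *m grad U x)).
  rewrite mulmxA mxtrace_mulC /mxtrace big_ord1 mxE; apply: eq_bigr => l _.
  rewrite mxE mxE; congr (_ * _); apply: eq_bigr => p _.
  by rewrite !mxE.
have -> : ricci H y z z = _ := mxE _ _ _ _.
rewrite mulmxDr linearD/= -nrm -div_raise_grad//.
have lin : \sum_k (pd k (christoffel H k z z) y - pd z (christoffel H k z k) y) =
   \sum_k (2 * expR (2 * U x) * (pd k U x * raise_grad k x) + expR (2 * U x) * pd k
     (raise_grad k) x).
  rewrite split_sum subrr add0r.
  apply: eq_bigr => k _; rewrite (no_time (fun y => @Grzr k k y) Dy) subr0.
  rewrite (@pd_r k _ (fun x => expR (2 * U x) * raise_grad k x) y (fun y => @Grzz k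
    y) Dy) pdM; last 2 first.
  - by case: (dE k).
  - exact: smooth_on_differentiable (sraise k) Wx.
  by rewrite (dE k).2 mulrA.
(* The negative term cancels half of the 2 e^(2U) |dU|^2 produced in [lin] by differentiating
   e^(2U). *)
have quad : \sum_k \sum_l (christoffel H k k l y * christoffel H l z z y -
      christoffel H k z l y * christoffel H l z k y) =
    0 + 0 + - (expR (2 * U x) * \sum_k pd k U x * raise_grad k x)
    + expR (2 * U x) * \sum_k \sum_l christoffel g k k l x * raise_grad l x.
  rewrite split_sum2; congr (_ + _ + _ + _).
  - exact: subrr.
  - by apply: big1 => l _; exact: subrr.
  - rewrite mulr_sumr -sumrN; apply: eq_bigr => k _; rewrite !(Gs Dy) mul0r sub0r -/x.
    by move: (expR _) (raise_grad _ _) (pd _ _ _) => a b c; ring.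
  - rewrite mulr_sumr; apply: eq_bigr => k _; rewrite mulr_sumr; apply: eq_bigr => l _.
    by rewrite !(Gs Dy) mul0r subr0 -/x; exact: mulrCA.
rewrite lin quad.
rewrite big_split/= -!mulr_sumr.
move: (expR _) (\sum_k _ * _) (\sum_k pd _ _ _) (\sum_k \sum_l _) => a b c d.
ring.
Qed.

Lemma static_ricci y : W (rsubmx y) -> ricci H y =
  block_mx (expR (2 * U (rsubmx y)) *
      \tr (invmx (g (rsubmx y)) *m (hessian g U (rsubmx y)
                                    + (grad U (rsubmx y))^T *m grad U (rsubmx y))))%:M 0
    0 (ricci g (rsubmx y) - hessian g U (rsubmx y) - (grad U (rsubmx y))^T *m grad U
      (rsubmx y)).
Proof.
move=> Dy; rewrite -[LHS]submxK; congr block_mx; apply/matrixP => i j.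
- by rewrite [LHS]mxE [LHS]mxE !ord1 static_ricci_zz// [RHS]mxE eqxx.
- by rewrite [LHS]mxE [LHS]mxE !ord1 static_ricci_zr// mxE.
- by rewrite [LHS]mxE [LHS]mxE !ord1 static_ricci_rz// mxE.
- rewrite [LHS]mxE [LHS]mxE static_ricci_rr//.
  have addE (A B : 'M[R]_n) : (A - B) i j = A i j - B i j by rewrite mxE [X in _ +
    X]mxE.
  by rewrite !addE [(_ *m grad _ _) _ _]mxE big_ord1 !mxE.
Qed.

End static_metric.

(** * Type D endomorphisms *)

Section type_D_algebra.
Variable F : realFieldType.
Implicit Types (A q : 'M[F]_3) (mu : F) (c : 'cV[F]_3) (r : 'rV[F]_3).

Lemma rank1_factor (B : 'M[F]_3) : \rank B = 1%N -> exists c r, B = c *m r.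
Proof.
move: (col_base B) (row_base B) (mulmx_base B) => C R + rk; rewrite rk in C R *.
by move=> <-; exists C, R.
Qed.

(** An eigenspace of dimension two makes A - mu a matrix of rank one, hence a column times a row;
    its trace - 3 mu fixes the normalisation. Thus [c *m r] projects on the simple eigenline,
    without diagonalising A. *)
Lemma eigenspace_rank2_factor A mu : mu != 0 -> \tr A = 0 ->
  \rank (eigenspace A mu) = 2%N ->
  exists c r, A = mu%:M - (3 * mu) *: (c *m r) /\ r *m c = 1%:M.
Proof.
move=> mu0 trA; rewrite /eigenspace mxrank_ker => rk.
have rk1 : \rank (A - mu%:M) = 1%N.
  by move: rk (rank_leq_row (A - mu%:M)); case: (\rank _) => [|[|[|[|]]]].
have [c [r E]] := rank1_factor rk1.
have n0 : - 3 * mu != 0 by rewrite mulf_neq0// oppr_eq0 pnatr_eq0.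
have trcr : (r *m c) 0 0 = - 3 * mu.
  rewrite -trace_mx11 mxtrace_mulC -E linearB/= trA.
  by rewrite mxtrace_scalar sub0r mulNr mulr_natl.
exists ((- 3 * mu)^-1 *: c), r; split.
  rewrite -scalemxAl -E scalerA -scaleNr (_ : - (3 * mu * (- 3 * mu)^-1) = 1).
    by rewrite scale1r addrC subrK.
  by field.
apply/matrixP => i j; rewrite !ord1 -scalemxAr mxE trcr mulVf//.
by rewrite mxE eqxx.
Qed.

Lemma idempotent_factor q : q *m q = q -> \tr q = 1 ->
  exists c r, q = c *m r /\ r *m c = 1%:M.
Proof.
move=> qq trq; have Eq := mulmx_base q.
have [C' HC'] := row_fullP (col_base_full q).
have [R' HR'] := row_freeP (row_base_free q).
(* Stated for any inner dimension k, as the rank of q is not yet known; D and S cancel the full-rank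
   factors in q q = q. *)
have gen k (C : 'M[F]_(3, k)) (R : 'M[F]_(k, 3)) D S : D *m C = 1%:M ->
    R *m S = 1%:M -> C *m R = q -> R *m C = 1%:M.
  move=> DC RS CR; have : D *m (q *m q) *m S = D *m q *m S by rewrite qq.
  by rewrite -CR !mulmxA DC !mul1mx -!mulmxA RS mulmx1.
have RC := gen _ _ _ _ _ HC' HR' Eq.
(* The trace of the identity matrix [row_base q *m col_base q] counts the rank, and it equals tr
   q. *)
have rk : \rank q = 1%N.
  have : \tr (row_base q *m col_base q) = 1 by rewrite mxtrace_mulC Eq.
  by rewrite RC mxtrace1 => /eqP; rewrite -[1 in X in X -> _]/(1%:R) eqr_nat => /eqP.
move: (col_base q) (row_base q) Eq RC => C R; rewrite rk in C R *.
by move=> <- RC; exists C, R.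
Qed.

Lemma factor_ranks c r mu (A := mu%:M - (3 * mu) *: (c *m r)) :
  r *m c = 1%:M -> mu != 0 ->
  \rank (eigenspace A mu) = 2%N /\ \rank (eigenspace A (- 2 * mu)) = 1%N.
Proof.
move=> rc mu0; have n0 : 3 * mu != 0 by rewrite mulf_neq0// pnatr_eq0.
have r0 : r != 0.
  apply/eqP => r0; move: rc; rewrite r0 mul0mx => /matrixP/(_ 0 0).
  by rewrite !mxE eqxx => /esym/eqP; rewrite oner_eq0.
have cr0 : c *m r != 0.
  apply/eqP => cr0; have : r *m (c *m r) *m c = 0 by rewrite cr0 mulmx0 mul0mx.
  rewrite mulmxA rc mul1mx rc => /matrixP/(_ 0 0).
  by rewrite !mxE eqxx => /eqP; rewrite oner_eq0.
split; rewrite /eigenspace.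
  rewrite mxrank_ker /A addrAC subrr sub0r mxrank_opp mxrank_scale_nz//.
  have -> : \rank (c *m r) = 1%N.
    apply/eqP; rewrite eqn_leq lt0n mxrank_eq0 cr0 andbT.
    exact: leq_trans (mxrankM_maxl _ _) (rank_leq_col _).
  by [].
have -> : A - (- 2 * mu)%:M = (3 * mu) *: (1%:M - c *m r).
  rewrite /A scalerBr scalemx1 addrAC -raddfB/=; congr (_%:M - _); ring.
(* A row v fixed by [c *m r] is the multiple [v *m c] of r. *)
have E : (kermx ((3 * mu) *: (1%:M - c *m r)) :=: r)%MS.
  apply/eqmxP/andP; split.
    have : kermx ((3 * mu) *: (1%:M - c *m r)) *m ((3 * mu) *: (1%:M - c *m r)) = 0.
      exact: mulmx_ker.
    rewrite -scalemxAr => /eqP; rewrite scaler_eq0 (negPf n0)/= mulmxBr mulmx1 subr_eq0.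
    by move=> /eqP E; rewrite {1}E mulmxA submxMl.
  apply/sub_kermxP; rewrite -scalemxAr mulmxBr mulmx1 mulmxA rc mul1mx subrr.
  by rewrite scaler0.
by rewrite E; apply/eqP; rewrite eqn_leq rank_leq_row lt0n mxrank_eq0.
Qed.

Lemma type_D_traces q mu (A := mu%:M - (3 * mu) *: q) : q *m q = q -> \tr q = 1 ->
  [/\ \tr (A *m A) = 6 * mu ^+ 2, \tr (A *m A *m A) = - 6 * mu ^+ 3 &
      6 *: (A *m A) - (6 * mu ^+ 2)%:M = (18 * mu ^+ 2) *: q].
Proof.
move=> qq trq.
have A2 : A *m A = (mu ^+ 2)%:M + (3 * mu ^+ 2) *: q.
  rewrite /A mulmxBl !mulmxBr -!scalemxAl -!scalemxAr qq -scalar_mxM.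
  rewrite mul_scalar_mx mul_mx_scalar.
  by apply/matrixP => i j; rewrite !mxE; case: (i == j) => /=; ring.
have A3 : A *m A *m A = (mu ^+ 3)%:M - (9 * mu ^+ 3) *: q.
  rewrite A2 /A mulmxDl !mulmxBr -!scalemxAl -!scalemxAr qq -scalar_mxM.
  rewrite mul_scalar_mx mul_mx_scalar.
  by apply/matrixP => i j; rewrite !mxE; case: (i == j) => /=; ring.
have trS a : \tr (a%:M : 'M[F]_3) = 3 * a by rewrite mxtrace_scalar mulr_natl.
split.
- by rewrite A2 mxtraceD mxtraceZ trq trS; ring.
- by rewrite A3 linearB/= mxtraceZ trq trS; ring.
- by rewrite A2; apply/matrixP => i j; rewrite !mxE; case: (i == j) => /=; ring.
Qed.

(** Newton's identities give x^3 - (tr A^2 / 2) x - tr A^3 / 3 as characteristic polynomial of a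
    traceless A. Once the trace has eliminated a diagonal entry, each component is a polynomial
    identity. *)
Lemma Cayley_Hamilton3 A : \tr A = 0 ->
  A *m A *m A = (\tr (A *m A) / 2) *: A + (\tr (A *m A *m A) / 3)%:M.
Proof.
move=> tr0; have s3 := @sum3E F.
have m3 (B C : 'M[F]_3) i j : (B *m C) i j = _ := etrans (mxE _ _ _ _) (s3 _).
have t3 (B : 'M[F]_3) : \tr B = _ := s3 _.
pose o0 := Ordinal (isT : (0 < 3)%N); pose o1 := Ordinal (isT : (1 < 3)%N).
pose o2 := Ordinal (isT : (2 < 3)%N).
have E : A o0 o0 = - (A o1 o1 + A o2 o2).
  by apply/eqP; rewrite -addr_eq0 addrA; apply/eqP; rewrite -[RHS]tr0 t3.
apply/matrixP => i j; rewrite [RHS]mxE [X in _ = X + _]mxE [X in _ = _ + X]mxE !t3 !m3.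
elim/ord3_ind: i; elim/ord3_ind: j; rewrite ?eqxx /= ?mulr1n ?mulr0n
  -/o0 -/o1 -/o2 E; by field.
Qed.

(** The diagonal entries of S gi S are the squared norms of the rows of S. *)
Lemma sym_square_eq0 (gi S : 'M[F]_3) :
  (forall v : 'rV[F]_3, v != 0 -> 0 < (v *m gi *m v^T) 0 0) ->
  S^T = S -> S *m gi *m S = 0 -> S = 0.
Proof.
move=> pos ST S0; apply/row_matrixP => i; rewrite row0; apply/eqP/contraT => /pos.
rewrite tr_row ST -row_mul -[X in X < _]/(0).
have -> : (row i (S *m gi) *m col i S) 0 0 = (S *m gi *m S) i i.
  by rewrite !mxE; apply: eq_bigr => k _; rewrite !mxE.
by rewrite S0 mxE ltxx.
Qed.

(** For B = (A - mu) (A + 2 mu) the Cayley-Hamilton theorem reads A B = mu B, whence B^2 = (mu^2 +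
    mu^2 - 2 mu^2) B = 0. Since B g is symmetric, definiteness forces B = 0. The case mu = 0
    excludes a nonzero nilpotent A. *)
Lemma type_D_quadratic (g gi S : 'M[F]_3) mu (A := S *m gi) :
  (forall v : 'rV[F]_3, v != 0 -> 0 < (v *m gi *m v^T) 0 0) ->
  gi *m g = 1%:M -> g^T = g -> gi^T = gi -> S^T = S -> \tr A = 0 ->
  \tr (A *m A) = 6 * mu ^+ 2 -> \tr (A *m A *m A) = - 6 * mu ^+ 3 ->
  A *m A + mu *: A - (2 * mu ^+ 2)%:M = 0.
Proof.
move=> pos gig gT giT ST trA sA tA.
have := Cayley_Hamilton3 trA; rewrite sA tA => A3.
set B := _ - _; have ggi : g *m gi = 1%:M by exact: mulmx1C.
have Bg : B *m g = S *m gi *m S + mu *: S - (2 * mu ^+ 2) *: g.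
  rewrite /B mulmxBl mulmxDl -scalemxAl mul_scalar_mx /A -!mulmxA gig mulmx1.
  by rewrite !mulmxA.
have BgT : (B *m g)^T = B *m g.
  by rewrite Bg linearB linearD/= !linearZ/= !trmx_mul ST giT gT mulmxA.
have AB : A *m B = mu *: B.
  rewrite /B mulmxBr mulmxDr mulmxA A3 -scalemxAr mul_mx_scalar.
  apply/matrixP => i j; rewrite !mxE; move: (A i j) (\sum_k _) => x y.
  by case: (i == j); rewrite /= ?mulr1n ?mulr0n; field.
have BB : B *m B = 0.
  rewrite {1}/B mulmxBl mulmxDl -mulmxA !AB -scalemxAr AB -scalemxAl AB mul_scalar_mx.
  by rewrite !scalerA -scalerDl -scalerBl (_ : _ - _ = 0) ?scale0r//; ring.
have := sym_square_eq0 pos BgT; rewrite -!mulmxA [g *m (gi *m _)]mulmxA ggi mul1mx.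
rewrite mulmxA BB mul0mx => /(_ erefl) Bg0.
by rewrite -[B]mulmx1 -ggi mulmxA Bg0 mul0mx.
Qed.

End type_D_algebra.

(** * From the conditions to a static vacuum metric *)

(** The hypothesis says that V is locally a constant multiple of e^U; the two forms of the static
    equation are exchanged here, in both directions of the theorem. *)
Lemma hessian_exp (R : realType) n (W : set 'rV[R]_n) (g : 'rV[R]_n -> 'M[R]_n)
    (U V : 'rV[R]_n -> R) : open W -> smooth_on W U -> smooth_on W V ->
  (forall x k, W x -> pd k V x = V x * pd k U x) ->
  forall x, W x -> hessian g V x = V x *: (hessian g U x + (grad U x)^T *m grad U x).
Proof.
move=> oW sU sV VU x Wx; apply/matrixP => i j.
have hE f : hessian g f x i j = _ := mxE _ _ _ _.
rewrite scalemxE addmxE !hE; have -> : ((grad U x)^T *m grad U x) i j = pd i U x * pd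
  j U x.
  by rewrite mxE big_ord1 !mxE.
have -> : pd i (pd j V) x = pd i (fun y => V y * pd j U y) x.
  by apply: (pd_eq_on _ oW) Wx => y; exact: VU.
rewrite pdM; last 2 first.
- exact: smooth_on_differentiable sV Wx.
- exact: smooth_on_differentiable (smooth_on_pd j sU) Wx.
have -> : \sum_k christoffel g k i j x * pd k V x = V x * \sum_k christoffel g k i j
  x * pd k U x.
  by rewrite mulr_sumr; apply: eq_bigr => k _; rewrite VU// mulrCA.
rewrite VU//; move: (\sum_k _) => S; move: (V x) (pd i U x) (pd j U x) (pd i (pd j U)
  x).
by move=> a b c d; ring.
Qed.

Section type_D_metric.
#[local] Opaque pd christoffel.
Context {R : realType}.
Variables (W : set 'rV[R]_3) (g : 'rV[R]_3 -> 'M[R]_3).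
Hypothesis gW : metric_on W g.
Implicit Types (x : 'rV[R]_3).
Let oW : open W. Proof. by case: gW. Qed.
Let sg : smooth_mx W g. Proof. by case: gW. Qed.
Let gT x : W x -> (g x)^T = g x. Proof. by case: gW => _ _ + _; apply. Qed.
Let sgi : smooth_mx W (fun x => invmx (g x)). Proof. exact: smooth_metric_inv. Qed.
Let sric : smooth_mx W (ricci g). Proof. exact: smooth_ricci. Qed.

Lemma smooth_ricci_endo : smooth_mx W (ricci_endo g).
Proof. exact: smooth_mxM. Qed.
Let sA := smooth_ricci_endo.

Lemma smooth_sinv : smooth_on W (sinv g).
Proof. by apply: smooth_mxtrace => //; exact: smooth_mxM. Qed.

Lemma smooth_tinv : smooth_on W (tinv g).
Proof. by apply: smooth_mxtrace => //; apply: smooth_mxM => //; exact: smooth_mxM. Qed.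

Lemma smooth_Ptensor : smooth_mx W (Ptensor g).
Proof.
apply: smooth_mxB => //; apply: smooth_mxZ => //.
- exact: smooth_on_cst.
- by apply: smooth_mxM => //; exact: smooth_mxM.
- exact: smooth_sinv.
Qed.

(* The double eigenvalue mu, as s = 6 mu^2 and t = - 6 mu^3. *)
Definition weyl x : R := - tinv g x / sinv g x.

Lemma smooth_weyl : (forall x, W x -> sinv g x != 0) -> smooth_on W weyl.
Proof.
move=> s0; apply: smooth_onM => //; first by apply: smooth_onN => //; exact:
  smooth_tinv.
by apply: smooth_onV => //; exact: smooth_sinv.
Qed.

Lemma Ptensor_endo x : W x ->
  Ptensor g x = (6 *: (ricci_endo g x *m ricci_endo g x) - (sinv g x)%:M) *m g x.
Proof.
move=> Wx; rewrite mulmxBl mul_scalar_mx -scalemxAl; congr (_ *: _ - _).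
by rewrite /ricci_endo !mulmxA mulmxKV// (metric_unit gW Wx).
Qed.

(** * Invariants at a point of type D *)

Section pointwise.
Variables (x : 'rV[R]_3) (mu : R) (c : 'cV[R]_3) (r : 'rV[R]_3).
Hypotheses (Wx : W x) (mu0 : mu != 0) (rc : r *m c = 1%:M).
Hypothesis AE : ricci_endo g x = mu%:M - (3 * mu) *: (c *m r).

Let qq : (c *m r) *m (c *m r) = c *m r.
Proof. by rewrite mulmxA -(mulmxA c) rc mulmx1. Qed.
Let trq : \tr (c *m r) = 1. Proof. by rewrite mxtrace_mulC rc mxtrace1. Qed.

Lemma type_D_sinv : sinv g x = 6 * mu ^+ 2.
Proof. by rewrite /sinv AE; have [] := type_D_traces mu qq trq. Qed.

Lemma type_D_tinv : tinv g x = - 6 * mu ^+ 3.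
Proof. by rewrite /tinv AE; have [] := type_D_traces mu qq trq. Qed.

Lemma type_D_weyl : weyl x = mu.
Proof. by rewrite /weyl type_D_sinv type_D_tinv; field. Qed.

Lemma type_D_ricci : ricci g x = mu *: g x - (3 * mu) *: (c *m r *m g x).
Proof.
rewrite -[LHS](mulmxKV (metric_unit gW Wx)) -/(ricci_endo g x) AE mulmxBl.
by rewrite mul_scalar_mx -scalemxAl.
Qed.

Lemma type_D_proj_sym : (c *m r *m g x)^T = c *m r *m g x.
Proof.
have n0 : 3 * mu != 0 by rewrite mulf_neq0// pnatr_eq0.
have E : c *m r *m g x = (3 * mu)^-1 *: (mu *: g x - ricci g x).
  by rewrite type_D_ricci opprB addrC subrK scalerA mulVf// scale1r.
by rewrite E linearZ/= linearB/= linearZ/= gT// (ricci_tr gW).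
Qed.

Lemma type_D_Ptensor : Ptensor g x = (18 * mu ^+ 2) *: (c *m r *m g x).
Proof.
rewrite Ptensor_endo// type_D_sinv AE.
by have [_ _ ->] := type_D_traces mu qq trq; rewrite -scalemxAl.
Qed.

Lemma type_D_row (e : 'rV[R]_3) : e *m ricci_endo g x = (- 2 * mu) *: e ->
  e *m c *m r = e.
Proof.
rewrite AE mulmxBr mul_mx_scalar -scalemxAr mulmxA => E.
have n0 : 3 * mu != 0 by rewrite mulf_neq0// pnatr_eq0.
apply: (scalerI n0); move/eqP: E; rewrite subr_eq addrC -subr_eq -scalerBl.
by move=> /eqP <-; congr (_ *: _); ring.
Qed.

End pointwise.

Hypothesis trR0 : forall x, W x -> trR g x = 0.
Hypothesis st : forall x, W x -> 6 * tinv g x ^+ 2 = sinv g x ^+ 3.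
Hypothesis Pds : forall x, W x -> Pd g (sinv g) x != 0.

Let gi_pos x : W x -> forall v : 'rV[R]_3, v != 0 -> 0 < (v *m invmx (g x) *m v^T) 0 0.
Proof. by move=> Wx v; exact: (metric_inv_pos gW Wx). Qed.

(** The equation 6 t^2 = s^3 gives s >= 0. If s = 0 then t = 0, so R^2 = 0 by the quadratic equation
    with mu = 0, and P vanishes, against P(ds) <> 0. *)
Lemma sinv_gt0 x : W x -> 0 < sinv g x.
Proof.
move=> Wx; have s_ge0 : 0 <= sinv g x.
  rewrite leNgt; apply/negP => s0; have : 0 <= 6 * tinv g x ^+ 2 by rewrite
    mulr_ge0// sqr_ge0.
  by rewrite st// exprS pmulr_lge0; nra.
rewrite lt_neqAle s_ge0 andbT; apply/eqP => /esym s0.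
have t0 : tinv g x = 0.
  have /eqP := st Wx; rewrite s0 expr0n mulf_eq0 pnatr_eq0 sqrf_eq0/=.
  by move/eqP.
have := @type_D_quadratic R (g x) (invmx (g x)) (ricci g x) 0 (gi_pos Wx)
  (mulVmx (metric_unit gW Wx)) (gT Wx) (metric_inv_tr gW Wx) (ricci_tr gW Wx) (trR0 Wx).
rewrite -/(ricci_endo g x) -/(sinv g x) -/(tinv g x) s0 t0 !expr0n !mulr0 => /(_
  erefl erefl).
rewrite scale0r addr0 raddf0 subr0 => A2.
have S0 : ricci g x *m invmx (g x) *m ricci g x = 0.
  have -> : ricci g x *m invmx (g x) *m ricci g x = ricci_endo g x *m ricci_endo g x
    *m g x.
    by rewrite /ricci_endo !mulmxA mulmxKV// (metric_unit gW Wx).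
  by rewrite A2 mul0mx.
have P0 : Ptensor g x = 0 by rewrite /Ptensor S0 s0 scaler0 scale0r subrr.
by have := Pds Wx; rewrite /Pd P0 !mul0mx eqxx.
Qed.

Lemma sinv_weyl x : W x -> sinv g x = 6 * weyl x ^+ 2.
Proof.
move=> Wx; have s0 := lt0r_neq0 (sinv_gt0 Wx); rewrite /weyl expr_div_n sqrrN.
by rewrite mulrA st//; field.
Qed.

Lemma weyl_neq0 x : W x -> weyl x != 0.
Proof.
move=> Wx; have := sinv_gt0 Wx; rewrite sinv_weyl//.
by apply: contraTneq => ->; rewrite expr0n mulr0 ltxx.
Qed.

Lemma type_D_factor x : W x -> exists (c : 'cV[R]_3) (r : 'rV[R]_3), r *m c = 1%:M /\
  ricci_endo g x = (weyl x)%:M - (3 * weyl x) *: (c *m r).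
Proof.
move=> Wx; set mu := weyl x; have mu0 : mu != 0 := weyl_neq0 Wx.
have sE : sinv g x = 6 * mu ^+ 2 := sinv_weyl Wx.
have tE : tinv g x = - 6 * mu ^+ 3.
  have s0 := lt0r_neq0 (sinv_gt0 Wx).
  have : tinv g x = - mu * sinv g x by rewrite /mu /weyl; field.
  by rewrite sE => ->; ring.
have := @type_D_quadratic R (g x) (invmx (g x)) (ricci g x) mu (gi_pos Wx)
  (mulVmx (metric_unit gW Wx)) (gT Wx) (metric_inv_tr gW Wx) (ricci_tr gW Wx) (trR0
    Wx) sE tE.
rewrite -/(ricci_endo g x); move: (trR0 Wx); rewrite /trR; move: (ricci_endo g x) =>
  A trA A2.
have n0 : 3 * mu != 0 by rewrite mulf_neq0// pnatr_eq0.
(* Solved from the wanted form of [A]; the quadratic equation is exactly what makes it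
   idempotent. *)
pose q := (3 * mu)^-1 *: (mu%:M - A).
have AE : A = mu%:M - (3 * mu) *: q.
  by rewrite /q scalerA mulfV// scale1r opprB addrC subrK.
have qq : q *m q = q.
  have A2E : A *m A = (2 * mu ^+ 2)%:M - mu *: A.
    by move/eqP: A2; rewrite subr_eq0 => /eqP <-; rewrite addrK.
  rewrite /q -scalemxAl -scalemxAr mulmxBl !mulmxBr A2E mul_scalar_mx mul_mx_scalar.
  rewrite mul_scalar_mx; apply/matrixP => i j; rewrite !mxE.
  by move: (A i j) => y; case: (i == j); rewrite /= ?mulr1n ?mulr0n; field.
have trq : \tr q = 1.
  rewrite mxtraceZ linearB/= trA mxtrace_scalar subr0 -[mu *+ 3]mulr_natl.
  by rewrite mulVf.
by have [c [r [qE rc]]] := idempotent_factor qq trq; exists c, r; rewrite -qE.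
Qed.

Let f x := sinv g x `^ (- (2 / 3)).

Let sf : smooth_on W f.
Proof. by apply: smooth_on_powR => //; [exact: sinv_gt0|exact: smooth_sinv]. Qed.

Let grad_f x : W x ->
  grad f x = (- (2 / 3) * sinv g x `^ (- (2 / 3) - 1)) *: grad (sinv g) x.
Proof.
move=> Wx; apply/rowP => i; rewrite !mxE.
have ds := smooth_on_differentiable smooth_sinv Wx.
by have [_ ->] := pd_comp i (is_derive1_powR (- (2 / 3)) (sinv_gt0 Wx)) ds.
Qed.

(** P is a positive multiple of Q = Q g^-1 Q, so the value is a positive multiple of the squared
    norm of w = Q(df). As df is a nonzero multiple of ds, w = 0 would give P(ds) = 0. *)
Lemma Pdd_gt0 x : W x -> 0 < Pdd g f f x.
Proof.
move=> Wx; have [c [r [rc AE]]] := type_D_factor Wx; have mu0 := weyl_neq0 Wx.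
have PE := type_D_Ptensor Wx rc AE; have QT := type_D_proj_sym Wx mu0 AE.
set Q := c *m r *m g x in PE QT; set w := grad f x *m invmx (g x) *m Q.
have QQ : Q *m invmx (g x) *m Q = Q.
  rewrite /Q -[c *m r *m g x *m _ *m _]mulmxA mulmxA mulmxK ?(metric_unit gW)//.
  by rewrite !mulmxA -(mulmxA c) rc mulmx1.
have wT : w^T = Q *m invmx (g x) *m (grad f x)^T.
  by rewrite /w trmx_mul QT trmx_mul (metric_inv_tr gW Wx) mulmxA.
have -> : Pdd g f f x = 18 * weyl x ^+ 2 * (w *m invmx (g x) *m w^T) 0 0.
  rewrite /Pdd PE -scalemxAr -!scalemxAl mxE; congr (_ * _).
  by rewrite wT /w -[in LHS]QQ !mulmxA.
apply: mulr_gt0; first by rewrite mulr_gt0// exprn_even_gt0.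
apply: gi_pos => //; apply: contra (Pds Wx) => /eqP w0.
have : w^T = 0 by rewrite w0 trmx0.
rewrite wT grad_f// linearZ/= -scalemxAr => /eqP; rewrite scaler_eq0.
rewrite mulf_eq0 oppr_eq0 mulf_eq0 invr_eq0 !pnatr_eq0/= gt_eqF ?powR_gt0 ?sinv_gt0//=.
by move=> /eqP E; rewrite /Pd PE -!scalemxAl E scaler0.
Qed.

Let V := Vpot g.

Lemma smooth_Vpot : smooth_on W V.
Proof.
apply: smooth_on_sqrt => //; first exact: Pdd_gt0.
have sgr := smooth_grad sf.
have sP := smooth_Ptensor.
apply: (smooth_mxM oW (smooth_mxM oW (smooth_mxM oW (smooth_mxM oW sgr sgi) sP) sgi)).
exact: smooth_mx_tr.
Qed.

Lemma Vpot_gt0 x : W x -> 0 < V x.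
Proof. by move=> Wx; rewrite sqrtr_gt0 Pdd_gt0. Qed.

Hypothesis hessV : forall x, W x -> ricci g x = (V x)^-1 *: hessian g V x.

Let U x := ln (V x).

Let sU : smooth_on W U.
Proof. by apply: smooth_on_ln => //; [exact: Vpot_gt0|exact: smooth_Vpot]. Qed.

Let pdV x k : W x -> pd k V x = V x * pd k U x.
Proof.
move=> Wx; have dV := smooth_on_differentiable smooth_Vpot Wx.
have [_ ->] := pd_comp k (is_derive1_ln (Vpot_gt0 Wx)) dV.
by rewrite mulVKf// gt_eqF// Vpot_gt0.
Qed.

Lemma conditions_static_vacuum : static_vacuum W g U.
Proof.
split=> [//|y Wy]; rewrite (static_ricci gW sU Wy).
have E : hessian g U (rsubmx y) + (grad U (rsubmx y))^T *m grad U (rsubmx y)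
    = ricci g (rsubmx y).
  rewrite hessV// (hessian_exp g oW sU smooth_Vpot pdV)// scalerA mulVf ?scale1r//.
  by rewrite gt_eqF// Vpot_gt0.
rewrite -addrA -opprD E subrr mxtrace_mulC -/(ricci_endo g _) -/(trR g _) trR0//.
by rewrite mulr0 raddf0 -[RHS]submxK; congr block_mx; apply/matrixP => i j; rewrite
  !mxE.
Qed.

Lemma conditions_AC_metric : AC_metric W g U.
Proof.
split; first exact: conditions_static_vacuum.
exists weyl => x Wx; have [c [r [rc AE]]] := type_D_factor Wx; have mu0 := weyl_neq0 Wx.
have [r2 r1] := factor_ranks rc mu0.
split; first by split; rewrite // AE.
move=> e e1 Ae; have s0 y : W y -> sinv g y != 0 by move=> Wy; rewrite gt_eqF//
  sinv_gt0.
have sw := smooth_weyl s0; have dw := smooth_on_differentiable sw Wx.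
apply: contraNneq (Pds Wx) => De.
have ds : (e *m (grad (sinv g) x)^T) 0 0 = 0.
  have E k : pd k (sinv g) x = 12 * weyl x * pd k weyl x.
    transitivity (pd k (fun y => 6 * weyl y ^+ 2) x).
      by apply: (pd_eq_on _ oW) Wx => y; exact: sinv_weyl.
    rewrite pdZ; last exact: differentiable_exprn.
    by rewrite (pdX k 1 dw); ring.
  move: De; rewrite derive_pd// => De.
  transitivity (12 * weyl x * \sum_k e 0 k * pd k weyl x); last by rewrite De mulr0.
  rewrite mxE mulr_sumr; apply: eq_bigr => k _; rewrite !mxE E.
  by move: (e 0 k) (pd k weyl x) (weyl x) => a b d; ring.
have ee := type_D_row mu0 AE Ae.
have ec0 : (e *m c) 0 0 != 0.
  apply/eqP => z; have ec : e *m c = 0 by apply/matrixP => i j; rewrite !ord1 z mxE.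
  move: e1; rewrite -ee ec mul0mx /inner !mul0mx mxE => /esym/eqP.
  by rewrite oner_eq0.
(* [e] is the nonzero scalar [e *m c] times [r], so s is stationary along [r] too; up to a scalar
   P(ds) is [c] times that derivative. *)
have rds : r *m (grad (sinv g) x)^T = 0.
  apply/matrixP => i j; rewrite !ord1 [RHS]mxE; apply: (mulfI ec0); rewrite mulr0
    -[RHS]ds.
  have -> : e *m (grad (sinv g) x)^T = (e *m c) *m (r *m (grad (sinv g) x)^T).
    by rewrite mulmxA ee.
  by rewrite [RHS]mxE big_ord1.
rewrite /Pd (type_D_Ptensor Wx rc AE) -!scalemxAl mulmxK ?(metric_unit gW)//.
by rewrite -mulmxA rds mulmx0 scaler0.
Qed.

End type_D_metric.

(** * From a static vacuum metric to the conditions *)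

Lemma metric_on_sub (R : realType) n (W W' : set 'rV[R]_n) (g : 'rV[R]_n -> 'M[R]_n) :
  open W' -> W' `<=` W -> metric_on W g -> metric_on W' g.
Proof.
move=> oW' sW [oW sg gT gpos]; split=> //.
- by move=> i j; apply: smooth_on_sub (sg i j).
- by move=> x /sW; exact: gT.
- by move=> x v /sW; exact: gpos.
Qed.

Section AC_metric_conditions.
#[local] Opaque pd christoffel.
Context {R : realType}.
Variables (W : set 'rV[R]_3) (g : 'rV[R]_3 -> 'M[R]_3) (U : 'rV[R]_3 -> R).
Hypotheses (gW : metric_on W g) (AC : AC_metric W g U).
Implicit Types (x y : 'rV[R]_3).
Let oW : open W. Proof. by case: gW. Qed.
Let sg : smooth_mx W g. Proof. by case: gW. Qed.
Let sU : smooth_on W U. Proof. by case: AC => -[]. Qed.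

Lemma static_vacuum_ricci x : W x ->
  ricci g x = hessian g U x + (grad U x)^T *m grad U x /\ trR g x = 0.
Proof.
(* Ricci-flatness is read off on the slice T = 0: the spatial block gives the static equation, the
   time block then the vanishing trace. *)
move=> Wx; have [[_ /(_ (row_mx 0 x))]] := AC.
rewrite row_mxKr => /(_ Wx) + _; rewrite (static_ricci gW sU) row_mxKr// => E.
have E1 := congr1 ulsubmx E; have E2 := congr1 drsubmx E.
rewrite block_mxKul in E1; rewrite block_mxKdr in E2.
have ricE : ricci g x = hessian g U x + (grad U x)^T *m grad U x.
  apply/eqP; rewrite -subr_eq0 opprD addrA; apply/eqP; rewrite E2.
  by apply/matrixP => i j; rewrite !mxE.
split=> //; move: E1; rewrite -ricE mxtrace_mulC -/(ricci_endo g x) -/(trR g x).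
move=> /matrixP/(_ 0 0); rewrite !mxE eqxx mulr1n => /eqP.
by rewrite mulf_eq0 gt_eqF ?expR_gt0//= => /eqP.
Qed.

Lemma AC_factor x : W x -> exists (mu : R) (c : 'cV[R]_3) (r : 'rV[R]_3),
  [/\ mu != 0, r *m c = 1%:M & ricci_endo g x = mu%:M - (3 * mu) *: (c *m r)].
Proof.
move=> Wx; have [_ [mu /(_ x Wx) [[mu0 rk _] _]]] := AC.
have [c [r [AE rc]]] := eigenspace_rank2_factor mu0 (static_vacuum_ricci Wx).2 rk.
by exists (mu x), c, r.
Qed.

Let mu := weyl g.

(** Replaces the eigenvalue supplied by [AC_metric] by [weyl g], a quotient of smooth invariants. *)
Lemma AC_weyl x : W x -> exists (c : 'cV[R]_3) (r : 'rV[R]_3),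
  [/\ mu x != 0, r *m c = 1%:M & ricci_endo g x = (mu x)%:M - (3 * mu x) *: (c *m r)].
Proof.
move=> Wx; have [nu [c [r [nu0 rc AE]]]] := AC_factor Wx.
by rewrite /mu (type_D_weyl nu0 rc AE); exists c, r.
Qed.

Let mu0 x : W x -> mu x != 0. Proof. by move=> /AC_weyl[c [r []]]. Qed.

Lemma AC_sinv x : W x -> sinv g x = 6 * mu x ^+ 2.
Proof. by move=> /AC_weyl[c [r [_ rc AE]]]; exact: type_D_sinv rc AE. Qed.

Lemma AC_tinv x : W x -> tinv g x = - 6 * mu x ^+ 3.
Proof. by move=> /AC_weyl[c [r [_ rc AE]]]; exact: type_D_tinv rc AE. Qed.

Lemma AC_sinv_gt0 x : W x -> 0 < sinv g x.
Proof. by move=> Wx; rewrite AC_sinv// mulr_gt0// exprn_even_gt0// mu0. Qed.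

Let smu : smooth_on W mu.
Proof. by apply: (smooth_weyl gW) => x Wx; rewrite gt_eqF// AC_sinv_gt0. Qed.

(** The tensor e (x) e with lower indices. It is smooth on all of W, whatever the sign of e. *)
Let Q x : 'M[R]_3 := (3 * mu x)^-1 *: (mu x *: g x - ricci g x).

Let QE x (c : 'cV[R]_3) (r : 'rV[R]_3) : W x ->
  ricci_endo g x = (mu x)%:M - (3 * mu x) *: (c *m r) -> Q x = c *m r *m g x.
Proof.
move=> Wx AE; have n0 : 3 * mu x != 0 by rewrite mulf_neq0 ?pnatr_eq0// mu0.
by rewrite /Q (type_D_ricci gW Wx AE) opprB addrC subrK scalerA mulVf// scale1r.
Qed.

Let ricQ x : W x -> ricci g x = mu x *: g x - (3 * mu x) *: Q x.
Proof.
by move=> Wx; have [c [r [_ _ AE]]] := AC_weyl Wx; rewrite (QE Wx AE) -(type_D_ricci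
  gW Wx AE).
Qed.

Let QT x : W x -> (Q x)^T = Q x.
Proof.
move=> Wx; have [c [r [m0 rc AE]]] := AC_weyl Wx.
by rewrite (QE Wx AE); exact: (type_D_proj_sym gW Wx m0 AE).
Qed.

Let Q_rank1 x i j k l : W x -> Q x i j * Q x k l = Q x i l * Q x k j.
Proof.
move=> Wx; have [c [r [m0 rc AE]]] := AC_weyl Wx.
have E a b : Q x a b = c a 0 * (r *m g x) 0 b by rewrite (QE Wx AE) -mulmxA mxE
  big_ord1.
by rewrite !E; ring.
Qed.

Let Qidem x : W x -> Q x *m invmx (g x) *m Q x = Q x.
Proof.
move=> Wx; have [c [r [m0 rc AE]]] := AC_weyl Wx; rewrite (QE Wx AE).
by rewrite mulmxK ?(metric_unit gW)// !mulmxA -(mulmxA c) rc mulmx1.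
Qed.

Let trQ x : W x -> \tr (Q x *m invmx (g x)) = 1.
Proof.
move=> Wx; have [c [r [m0 rc AE]]] := AC_weyl Wx; rewrite (QE Wx AE).
by rewrite mulmxK ?(metric_unit gW)// mxtrace_mulC rc mxtrace1.
Qed.

Let PE x : W x -> Ptensor g x = (18 * mu x ^+ 2) *: Q x.
Proof.
move=> Wx; have [c [r [m0 rc AE]]] := AC_weyl Wx; rewrite (QE Wx AE).
exact: (type_D_Ptensor gW Wx rc AE).
Qed.

Let sQ : smooth_mx W Q.
Proof.
apply: smooth_mxZ => //; last first.
  by apply: smooth_mxB => //; [exact: smooth_mxZ|exact: smooth_ricci].
apply: smooth_onV => // [x Wx|]; first by rewrite mulf_neq0 ?pnatr_eq0// mu0.
by apply: smooth_onM => //; exact: smooth_on_cst.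
Qed.

(** By Q g^-1 Q = Q the diagonal entries are squared norms of the rows, and Q is nonzero because its
    trace is 1. *)
Let Q_diag x : W x -> exists j, 0 < Q x j j.
Proof.
move=> Wx; have Q0 : Q x != 0.
  apply/eqP => Q0; have := trQ Wx; rewrite Q0 mul0mx mxtrace0 => /esym/eqP.
  by rewrite oner_eq0.
have [j rj] : exists j, row j (Q x) != 0.
  apply/existsP; rewrite -negb_forall; apply: contra Q0 => /forallP rQ.
  by apply/eqP/row_matrixP => j; rewrite row0; apply/eqP.
exists j; have := metric_inv_pos gW Wx rj; rewrite tr_row QT//.
have -> : (row j (Q x) *m invmx (g x) *m col j (Q x)) 0 0 =
    (Q x *m invmx (g x) *m Q x) j j.
  by rewrite -row_mul !mxE; apply: eq_bigr => k _; rewrite !mxE.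
by rewrite Qidem.
Qed.

(** Since s / 6 = mu^2, this is |mu|^(-1/3), written as a power of a positive smooth function. *)
Let m x := (sinv g x / 6) `^ (- 6^-1).

Let s6_gt0 x : W x -> 0 < sinv g x / 6.
Proof. by move=> Wx; rewrite divr_gt0// AC_sinv_gt0. Qed.

Let m_gt0 x : W x -> 0 < m x.
Proof. by move=> Wx; rewrite powR_gt0// s6_gt0. Qed.

Let sm : smooth_on W m.
Proof.
apply: smooth_on_powR => //; apply: smooth_onM => //; last exact: smooth_on_cst.
exact: smooth_sinv.
Qed.

Let mX k x : W x -> m x ^+ k = (sinv g x / 6) `^ (- 6^-1 * k%:R).
Proof. by move=> Wx; rewrite -powR_mulrn ?powR_ge0// -powRrM. Qed.

Let mu_m x : W x -> mu x ^+ 2 * m x ^+ 6 = 1.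
Proof.
move=> Wx; have s0 := s6_gt0 Wx; rewrite mX// (_ : - 6^-1 * 6%:R = - 1); last by field.
rewrite powR_inv1 ?ltW//; have -> : mu x ^+ 2 = sinv g x / 6 by rewrite AC_sinv//;
  field.
by rewrite mulfV// gt_eqF.
Qed.

Let s_powR x : W x -> sinv g x `^ (- (2 / 3)) = 6 `^ (- (2 / 3)) * m x ^+ 4.
Proof.
move=> Wx; have s0 := s6_gt0 Wx.
have -> : sinv g x = 6 * (sinv g x / 6) by field.
rewrite powRM ?ltW// mX//; congr (_ * _ `^ _); last by field.
Qed.

(** * A smooth eigenvector near a point *)

Section at_point.
Variables (x0 : 'rV[R]_3) (j : 'I_3).
Hypotheses (Wx0 : W x0) (Qj : 0 < Q x0 j j).

(** The interior is taken because Q is under control only on W, and its positivity set need not be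
    open elsewhere. *)
Let W' := W `&` (interior [set x | 0 < Q x j j]).

Let oW' : open W'. Proof. by apply: openI => //; exact: open_interior. Qed.

Let W'x0 : W' x0.
Proof.
split => //; have dQ := smooth_on_differentiable (sQ j j) Wx0.
exact: (cvgr_gt (Q x0 j j) (differentiable_continuous dQ)).
Qed.

Let subW : W' `<=` W. Proof. exact: subIsetl. Qed.
Let Qj_gt0 x : W' x -> 0 < Q x j j. Proof. by case=> _ /interior_subset. Qed.
Let gW' : metric_on W' g. Proof. exact: metric_on_sub gW. Qed.

(** As Q_ij = e_i e_j, the quotient Q_ij / sqrt(Q_jj) is e_i with the sign that makes e_j
    positive. *)
Let X x : 'cV[R]_3 := \col_i (m x * Q x i j / Num.sqrt (Q x j j)).

Let sX : smooth_mx W' X.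
Proof.
move=> i k; under eq_fun do rewrite mxE.
have s1 a b : smooth_on W' (fun x => Q x a b) by apply: smooth_on_sub (sQ a b).
apply: smooth_onM => //; first by apply: smooth_onM => //; exact: smooth_on_sub sm.
apply: smooth_onV => // [x W'x|]; first by rewrite gt_eqF// sqrtr_gt0 Qj_gt0.
by apply: smooth_on_sqrt.
Qed.

Let XX x : W' x -> X x *m (X x)^T = m x ^+ 2 *: Q x.
Proof.
move=> W'x; apply/matrixP => i k.
have XE a : X x a 0 = m x * Q x a j / Num.sqrt (Q x j j) by rewrite mxE.
rewrite outerE scalemxE !XE; have Wx := subW W'x; have qj := Qj_gt0 W'x; have r2 :=
  sqr_sqrtr (ltW qj).
have r0 : Num.sqrt (Q x j j) != 0 by rewrite gt_eqF// sqrtr_gt0.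
have E : Q x i j * Q x k j = Q x i k * Q x j j.
  have QC a b : Q x a b = Q x b a by rewrite -{1}(QT Wx) mxE.
  by rewrite (QC k j) Q_rank1.
have -> : m x * Q x i j / Num.sqrt (Q x j j) * (m x * Q x k j / Num.sqrt (Q x j j)) =
    m x ^+ 2 * (Q x i j * Q x k j) / Num.sqrt (Q x j j) ^+ 2 by field.
by rewrite E r2; field; rewrite gt_eqF.
Qed.

Let m0 x : W' x -> m x != 0. Proof. by move=> /subW Wx; rewrite gt_eqF// m_gt0. Qed.

Let QX x : W' x -> Q x = (m x ^+ 2)^-1 *: (X x *m (X x)^T).
Proof. by move=> W'x; rewrite XX// scalerA mulVf ?scale1r// expf_neq0// m0. Qed.

Let ricX x : W' x -> ricci g x = mu x *: g x - (3 * mu x / m x ^+ 2) *: (X x *m (X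
  x)^T).
Proof. by move=> W'x; rewrite ricQ ?QX ?scalerA//; exact: subW. Qed.

Let normX x : W' x -> ((X x)^T *m invmx (g x) *m X x) 0 0 = m x ^+ 2.
Proof.
move=> W'x; rewrite -trace_mx11 -mulmxA mxtrace_mulC -mulmxA XX// -scalemxAr mxtraceZ.
by rewrite mxtrace_mulC trQ ?mulr1//; exact: subW.
Qed.

Let phi := flux g m X.

Let pd_phi k x : W' x -> pd k phi x = phi x * pd k U x.
Proof.
apply: (pd_flux gW' (smooth_on_sub subW sU) _ _ (smooth_on_sub subW smu)
  (smooth_on_sub subW sm) sX m0 _ ricX normX).
- by move=> y /subW Wy; exact: (static_vacuum_ricci Wy).2.
- by move=> y /subW Wy; rewrite (static_vacuum_ricci Wy).1 addrK.
- by move=> y /subW; exact: mu_m.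
Qed.

Let pd_mu_m k x : W' x -> pd k mu x = - 3 * mu x * (pd k m x / m x).
Proof.
apply: (pd_mu gW' (smooth_on_sub subW smu) (smooth_on_sub subW sm) m0).
by move=> y /subW; exact: mu_m.
Qed.

(** The raised X divided by m is a unit eigenvector e for - 2 mu, and e(mu) = - 3 mu phi / m. *)
Let phi_neq0 x : W' x -> phi x != 0.
Proof.
move=> W'x; have Wx := subW W'x; have mx0 := m0 W'x.
have [_ [nu H]] := AC; have [_] := H x Wx.
(* The supplied eigenvalue [nu] carries no smoothness assumption; agreement on all of W lets its
   derivative be computed from [mu]. *)
have nuE y : W y -> nu y = mu y.
  move=> Wy; have [[nu0 rk _] _] := H y Wy.
  have [c [r [AE rc]]] := eigenspace_rank2_factor nu0 (static_vacuum_ricci Wy).2 rk.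
  by rewrite /mu (type_D_weyl nu0 rc AE).
pose Xt := (X x)^T *m invmx (g x); pose e := (m x)^-1 *: Xt.
have giT := metric_inv_tr gW Wx.
have XtX : Xt *m X x = (m x ^+ 2)%:M by rewrite [LHS]mx11_scalar normX.
have AX : ricci_endo g x = (mu x)%:M - (3 * mu x / m x ^+ 2) *: (X x *m Xt).
  rewrite /ricci_endo ricX// mulmxBl -!scalemxAl mulmxV ?(metric_unit gW)//.
  by rewrite scalemx1 mulmxA.
move=> /(_ e); rewrite nuE// => De; have {De} : 'D_e nu x != 0.
  apply: De.
    rewrite /inner /e linearZ/= -!scalemxAl -scalemxAr mulmxKV ?(metric_unit gW)//.
    by rewrite trmx_mul trmxK giT mulmxA !scalemxE normX//; field.
  rewrite /e -scalemxAl scalerA [- 2 * _ * _]mulrC -scalerA; congr (_ *: _).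
  rewrite AX mulmxBr mul_mx_scalar -scalemxAr mulmxA XtX mul_scalar_mx scalerA
    -scalerBl.
  by congr (_ *: _); field.
have -> : 'D_e nu x = 'D_e mu x.
  by apply: near_eq_derive; apply: filterS (open_nbhs_nbhs (conj oW Wx)) => y; exact:
    nuE.
rewrite derive_pd; last exact: smooth_on_differentiable smu Wx.
apply: contra_neq; rewrite /phi /flux => p0.
transitivity (- 3 * mu x / m x * (((X x)^T *m invmx (g x) *m (grad m x)^T) 0 0 / m x)).
  rewrite mxE mulr_suml mulr_sumr; apply: eq_bigr => k _.
  rewrite pd_mu_m// /e scalemxE -/Xt [(grad m x)^T _ _]mxE [grad m x _ _]mxE.
  by move: (Xt 0 k) (pd k m x) => a b; field.
by rewrite p0 mulr0.
Qed.

Let Xm x : W' x -> (X x)^T *m invmx (g x) *m (grad m x)^T = (phi x * m x)%:M.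
Proof.
by move=> W'x; rewrite [LHS]mx11_scalar /phi /flux divfK// m0.
Qed.

Let grad_s x : W' x -> grad (sinv g) x = (- 36 * mu x ^+ 2 / m x) *: grad m x.
Proof.
move=> W'x; have Wx := subW W'x; have dmu := smooth_on_differentiable smu Wx.
apply/rowP => k; rewrite !mxE.
have -> : pd k (sinv g) x = pd k (fun y => 6 * mu y ^+ 2) x.
  by apply: (pd_eq_on _ oW) Wx => y; exact: AC_sinv.
rewrite pdZ; last exact: differentiable_exprn.
rewrite (pdX k 1 dmu) pd_mu_m//; have := m0 W'x.
by move: (mu x) (m x) (pd k m x) => a b d b0; field.
Qed.

Let Pd_neq0 : Pd g (sinv g) x0 != 0.
Proof.
have mx0 := m0 W'x0; have mux0 := mu0 Wx0.
have gs : (grad (sinv g) x0)^T = (- 36 * mu x0 ^+ 2 / m x0) *: (grad m x0)^T.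
  by rewrite (grad_s W'x0) linearZ.
rewrite /Pd gs PE// QX// -scalemxAr -!scalemxAl -!mulmxA.
rewrite (mulmxA _ _ (grad m x0)^T) Xm// mul_mx_scalar.
have X0 : X x0 != 0.
  apply/eqP => X0; have := normX W'x0; rewrite X0 mulmx0 mxE => /esym/eqP.
  by rewrite expf_eq0/= (negPf mx0).
have nz (a : R) (A : 'cV[R]_3) : a != 0 -> A != 0 -> a *: A != 0.
  by move=> a0 A0; rewrite scaler_eq0 negb_or a0.
have ne (a : nat) : (a.+1%:R : R) != 0 by rewrite pnatr_eq0.
have phi0 := phi_neq0 W'x0.
have mu2 := expf_neq0 2 mux0.
apply: (nz _ _ _); last apply: (nz _ _ _); last apply: (nz _ _ _); last apply: (nz _
  _ _ X0).
- by rewrite mulf_neq0 ?invr_eq0// mulf_neq0// oppr_eq0.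
- by rewrite mulf_neq0.
- by rewrite invr_eq0 expf_neq0.
- by rewrite mulf_neq0.
Qed.

Let f x := sinv g x `^ (- (2 / 3)).
(** 288 = 18 * 4^2: the 18 is the coefficient in P, the 4 comes from differentiating m^4, and the
    powers of 6 from s^(-2/3) = 6^(-2/3) m^4. *)
Let K : R := 288 * (6 `^ (- (2 / 3))) ^+ 2.

Let PddE x : W' x -> Pdd g f f x = K * phi x ^+ 2.
Proof.
move=> W'x; have Wx := subW W'x; have mx0 := m0 W'x.
have dm := smooth_on_differentiable sm Wx.
have gf : grad f x = (6 `^ (- (2 / 3)) * 4 * m x ^+ 3) *: grad m x.
  apply/rowP => k; rewrite !mxE.
  have -> : pd k f x = pd k (fun y => 6 `^ (- (2 / 3)) * m y ^+ 4) x.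
    by apply: (pd_eq_on _ oW) Wx => y; exact: s_powR.
  rewrite pdZ; last exact: differentiable_exprn.
  by rewrite (pdX k 3 dm) !mulrA.
have Xm' : grad m x *m invmx (g x) *m X x = (phi x * m x)%:M.
  have := congr1 trmx (Xm W'x).
  by rewrite !trmx_mul !trmxK (metric_inv_tr gW Wx) tr_scalar_mx mulmxA.
have gfT : (grad f x)^T = (6 `^ (- (2 / 3)) * 4 * m x ^+ 3) *: (grad m x)^T.
  by rewrite gf linearZ.
rewrite /Pdd gfT PE// QX// gf -!scalemxAl -!scalemxAr -!scalemxAl !scalerA.
have -> : grad m x *m invmx (g x) *m (X x *m (X x)^T) *m invmx (g x) *m (grad m x)^T =
    (grad m x *m invmx (g x) *m X x) *m ((X x)^T *m invmx (g x) *m (grad m x)^T).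
  by rewrite !mulmxA.
rewrite Xm' Xm// -scalar_mxM !mxE eqxx mulr1n /K.
have mu2 : mu x ^+ 2 = (m x ^+ 6)^-1.
  by rewrite -[LHS]mulr1 -(mulfV (expf_neq0 6 mx0)) mulrA mu_m// mul1r.
rewrite mu2; move: (6 `^ _) (phi x) (m x) mx0 => a b d d0.
by field.
Qed.

Let K_gt0 : 0 < K. Proof. by rewrite mulr_gt0// exprn_gt0// powR_gt0. Qed.

Let V2 x : W' x -> Vpot g x ^+ 2 = K * phi x ^+ 2.
Proof.
move=> W'x; rewrite /Vpot sqr_sqrtr PddE// mulr_ge0 ?sqr_ge0// ltW//.
Qed.

Let V_gt0 x : W' x -> 0 < Vpot g x.
Proof.
by move=> W'x; rewrite sqrtr_gt0 PddE// mulr_gt0// exprn_even_gt0// phi_neq0.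
Qed.

Let sphi : smooth_on W' phi.
Proof.
apply: smooth_onM => //; last by apply: smooth_onV => //; exact: smooth_on_sub sm.
have sgi := smooth_metric_inv gW'.
apply: (smooth_mxM oW' (smooth_mxM oW' (smooth_mx_tr sX) sgi)).
by apply: smooth_mx_tr; apply: smooth_grad; exact: smooth_on_sub sm.
Qed.

Let sV : smooth_on W' (Vpot g).
Proof.
apply: smooth_on_sqrt => // [x W'x|]; first by rewrite PddE// mulr_gt0//
  exprn_even_gt0// phi_neq0.
apply: smooth_on_eq (smooth_onM oW' (smooth_on_cst W' K) (smooth_onM oW' sphi sphi))
  => //.
by move=> x W'x; rewrite PddE// expr2.
Qed.

(** Differentiating V^2 = K phi^2 and dividing by 2 V avoids the sign of phi. *)
Let pdV x k : W' x -> pd k (Vpot g) x = Vpot g x * pd k U x.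
Proof.
move=> W'x; have dphi := smooth_on_differentiable sphi W'x.
have dV := smooth_on_differentiable sV W'x.
have : pd k (fun y => Vpot g y ^+ 2) x = pd k (fun y => K * phi y ^+ 2) x.
  by apply: (pd_eq_on _ oW') W'x => y; exact: V2.
rewrite (pdX k 1 dV) pdZ; last exact: differentiable_exprn.
rewrite (pdX k 1 dphi) pd_phi//; have V0 := V_gt0 W'x; have E2 := V2 W'x.
move: (Vpot g x) (phi x) (pd k U x) (pd k _ x) V0 E2 => v p u dv v0 E2 E.
have n0 : 2 * v != 0 by rewrite mulf_neq0 ?pnatr_eq0// gt_eqF.
apply: (mulfI n0); have -> : 2 * v * (v * u) = 2 * v ^+ 2 * u by ring.
by rewrite E2 -[2 * v]/(2%:R * v ^+ 1) E; ring.
Qed.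

Lemma AC_conditions_at : [/\ trR g x0 = 0,
  6 * tinv g x0 ^+ 2 = sinv g x0 ^+ 3, Pd g (sinv g) x0 != 0 &
  ricci g x0 = (Vpot g x0)^-1 *: hessian g (Vpot g) x0].
Proof.
split=> //; first exact: (static_vacuum_ricci Wx0).2.
  by rewrite AC_tinv// AC_sinv//; ring.
rewrite (hessian_exp g oW' (smooth_on_sub subW sU) sV (fun x k => @pdV x k) W'x0).
rewrite scalerA mulVf ?scale1r ?(static_vacuum_ricci Wx0).1//.
by rewrite gt_eqF// V_gt0.
Qed.

End at_point.

Lemma AC_metric_conditions x : W x -> [/\ trR g x = 0,
  6 * tinv g x ^+ 2 = sinv g x ^+ 3, Pd g (sinv g) x != 0 &
  ricci g x = (Vpot g x)^-1 *: hessian g (Vpot g) x].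
Proof. by move=> Wx; have [j Qj] := Q_diag Wx; exact: AC_conditions_at Wx Qj. Qed.

End AC_metric_conditions.

Lemma metric_on_chart (R : realType) n (M : smooth_manifold R n)
    (gamma : riemannian_metric M) (c : chart M) : metric_on (chart_image c) (gamma c).
Proof.
split; [exact: img_open|by move=> i j; exact: gcomp_smooth|exact: gcomp_sym|].
exact: gcomp_posdef.
Qed.

Theorem theorem2 (R : realType) (M : smooth_manifold R 3)
    (gamma : riemannian_metric M) :
  locally_spatial_AC gamma <->
  (forall (c : chart M) (x : 'rV[R]_3), chart_image c x ->
     [/\ trR (gamma c) x = 0,
         6 * tinv (gamma c) x ^+ 2 = sinv (gamma c) x ^+ 3,
         Pd (gamma c) (sinv (gamma c)) x != 0 &
         ricci (gamma c) x =
           (Vpot (gamma c) x)^-1 *: hessian (gamma c) (Vpot (gamma c)) x]).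
Proof.
split=> [loc c x cx|cond c x cx].
  have [W [U [oW Wx sW AC]]] := loc c x cx.
  exact: AC_metric_conditions (metric_on_sub oW sW (metric_on_chart gamma c)) AC x Wx.
(* In this direction the potential is explicit, and the whole chart image serves as
   neighbourhood. *)
exists (chart_image c), (fun y => ln (Vpot (gamma c) y)); split=> //.
  exact: img_open.
by apply: (conditions_AC_metric (metric_on_chart gamma c)) => y cy; have [] := cond c
  y cy.
Qed.
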